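(* Let $t_0<\tau<T$, and let $A^a(t)\in\mathbb{R}^{n\times n}$, $B^a(t)\in\mathbb{R}^{n\times m}$ (for $t\in[t_0,\tau]$), $A^p(t)\in\mathbb{R}^{n\times n}$, $B^p(t)\in\mathbb{R}^{n\times m}$ (for $t\in[\tau,T]$) and $H\in\mathbb{R}^{n\times n}$ be the ante- and post-event linearization matrices and the jump gain associated with a nominal state-input trajectory of a hybrid system with event time $\tau$, as described in the context. Let $Q$, $R$, $P_T$ be (possibly time-varying) positive definite symmetric matrices of sizes $n\times n$, $m\times m$, $n\times n$. Consider the problem of minimizing, over inputs $v$, the quadratic cost $$\frac12\int_{t_0}^{T}\left(z^TQ\,z+v^TR\,v\right)ds+\frac12 z(T)^TP_T\,z(T)$$ subject to the jump linear dynamics $$z(t_0)=z_0,\qquad \dot z=A^a(t)z+B^a(t)v,\ t\in[t_0,\tau],\qquad z^+=z^-+Hz^-,\ t=\tau,\qquad \dot z=A^p(t)z+B^p(t)v,\ t\in[\tau,T].$$ Then the solution of this optimal control problem is given by the feedback law $$v=-R^{-1}B^TP(t)z=:-K(t)z,$$ where $B=B^a$ before $\tau$ and $B=B^p$ after $\tau$, and $P(t)$ is the solution of the Riccati differential equation with jump $$P(T)=P_T,$$ $$-\dot P=(A^p)^TP+PA^p-PB^pR^{-1}(B^p)^TP+Q,\quad t\in[\tau,T],$$ $$P^-=(I+H)^TP^+(I+H),\quad t=\tau,$$ $$-\dot P=(A^a)^TP+PA^a-PB^aR^{-1}(B^a)^TP+Q,\quad t\in[t_0,\tau].$$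
   Context: The superscripts $-$ and $+$ denote the values at the event time $\tau$ immediately before and immediately after the jump (left and right limits at $\tau$); $I$ is the $n\times n$ identity matrix. Origin of the matrices. A hybrid system has sufficiently smooth control vector fields $f^a$ (before the event) and $f^p$ (after the event) from $\mathbb{R}^n\times\mathbb{R}^m\times\mathbb{R}$ to $\mathbb{R}^n$, a smooth event function $g:\mathbb{R}^n\times\mathbb{R}\to\mathbb{R}$ and a smooth impulse map $\Delta:\mathbb{R}^n\times\mathbb{R}\to\mathbb{R}^n$. A nominal trajectory with input $\mu$ consists of $\alpha^a$ with $\dot\alpha^a=f^a(\alpha^a,\mu,t)$ on $[t_0,\tau]$, $g(\alpha^a(\tau),\tau)=0$ at the event time, $\alpha^p(\tau)=\alpha^a(\tau)+\Delta(\alpha^a(\tau),\tau)$, and $\dot\alpha^p=f^p(\alpha^p,\mu,t)$ on $[\tau,T]$. With $D_k$ the derivative with respect to the $k$-th argument, $A^s(t)=D_1f^s(\alpha^s(t),\mu(t),t)$ and $B^s(t)=D_2f^s(\alpha^s(t),\mu(t),t)$ for $s\in\{a,p\}$. The jump gain is $$H=\frac{f^+-f^--\dot\Delta^-}{\dot g^-}D_1g^-+D_1\Delta^-,$$ where $f^+=f^p(\alpha^p(\tau),\mu(\tau),\tau)$, $f^-=f^a(\alpha^a(\tau),\mu(\tau),\tau)$, $D_k\Delta^-=D_k\Delta(\alpha^a(\tau),\tau)$, $D_kg^-=D_kg(\alpha^a(\tau),\tau)$, $\dot\Delta^-=D_1\Delta^-\cdot f^-+D_2\Delta^-$, $\dot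 g^-=D_1g^-\cdot f^-+D_2g^-$, and it is assumed that $\dot g^-\neq0$ (transversality). *)

(* Defs.v *)
From HB Require Import structures.
From mathcomp Require Import all_boot all_order all_algebra.
From mathcomp Require Import all_classical all_reals all_analysis.

Set Implicit Arguments.
Unset Strict Implicit.
Unset Printing Implicit Defensive.

Import Order.TTheory GRing.Theory Num.Theory.
Import numFieldNormedType.Exports.

Local Open Scope classical_set_scope.
Local Open Scope ring_scope.

(* Smoothness. Only C^1 regularity is asked of the data of a hybrid system;
   between finite-dimensional spaces, pointwise continuity of the differential
   is the same as its continuity in operator norm. *)
Definition C1 (R : realType) (U V : normedModType R) (f : U -> V) : Prop :=
  (forall p, differentiable f p) /\
  (forall w : U, continuous (fun p => 'd f p w)).

(* Jacobian for column vectors: the matrix J with 'd f x w = J *m w (the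
   library's [jacobian] is for row vectors, hence transposed). *)
Definition Jac (R : realType) (k l : nat) (f : 'cV[R]_k -> 'cV[R]_l)
    (x : 'cV[R]_k) : 'M[R]_(l, k) :=
  \matrix_(i < l, j < k) ('d f x (delta_mx j 0 : 'cV[R]_k) i 0).

Definition grad (R : realType) (k : nat) (f : 'cV[R]_k -> R)
    (x : 'cV[R]_k) : 'rV[R]_k :=
  \row_(j < k) 'd f x (delta_mx j 0 : 'cV[R]_k).

(* Values at the finitely many exceptional points are unconstrained. *)
Definition piecewise_continuous (R : realType) (V : normedModType R)
    (a b : R) (v : R -> V) : Prop :=
  [/\ exists s : seq R, forall t, t \in `]a, b[ -> t \notin s ->
        {for t, continuous v},
      forall t, t \in `[a, b[ -> exists l : V, v @ t^'+ --> l &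
      forall t, t \in `]a, b] -> exists l : V, v @ t^'- --> l].

(* x' = F(t, x) on [a, b]: x is continuous on [a, b] and the equation holds
   except at finitely many times, since F may depend on time through a
   piecewise continuous input. By the mean value theorem the exceptional set
   is spurious wherever t |-> F(t, x(t)) is continuous. *)
Definition solves_ode (R : realType) (V : normedModType R) (a b : R)
    (F : R -> V -> V) (x : R -> V) : Prop :=
  {within `[a, b], continuous x} /\
  exists s : seq R, forall t, t \in `]a, b[ -> t \notin s ->
    is_derive t 1 x (F t (x t)).

(* Differential equation with one jump at [tau]. The branches [xa] and [xp]
   are continuous on the closed phases, so [xa tau] and [xp tau] are the left
   and right limits x^- and x^+ of [x] at [tau]; the value [x tau] itself is
   immaterial. *)
Definition solves_jump_ode (R : realType) (V : normedModType R)
    (t0 tau T : R) (Fa Fp : R -> V -> V) (jump : V -> V -> Prop)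
    (x : R -> V) : Prop :=
  exists xa xp : R -> V,
    [/\ solves_ode t0 tau Fa xa,
        solves_ode tau T Fp xp,
        jump (xa tau) (xp tau),
        {in `[t0, tau[, x =1 xa} &
        {in `]tau, T], x =1 xp}].

Record hybrid_system (R : realType) (n m : nat) := HybridSystem {
  fa : 'cV[R]_n -> 'cV[R]_m -> R -> 'cV[R]_n;
  fp : 'cV[R]_n -> 'cV[R]_m -> R -> 'cV[R]_n;
  ev : 'cV[R]_n -> R -> R;
  imp : 'cV[R]_n -> R -> 'cV[R]_n;
  fa_C1 : C1 (fun p : 'cV[R]_n * 'cV[R]_m * R => fa p.1.1 p.1.2 p.2);
  fp_C1 : C1 (fun p : 'cV[R]_n * 'cV[R]_m * R => fp p.1.1 p.1.2 p.2);
  ev_C1 : C1 (fun p : 'cV[R]_n * R => ev p.1 p.2);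
  imp_C1 : C1 (fun p : 'cV[R]_n * R => imp p.1 p.2) }.

Record nominal_trajectory (R : realType) (n m : nat)
    (S : hybrid_system R n m) (t0 tau T : R) := NominalTrajectory {
  mu : R -> 'cV[R]_m;
  alphaa : R -> 'cV[R]_n;
  alphap : R -> 'cV[R]_n;
  mu_pc : piecewise_continuous t0 T mu;
  alphaa_ode : solves_ode t0 tau (fun t x => fa S x (mu t) t) alphaa;
  event : ev S (alphaa tau) tau = 0;
  impact : alphap tau = alphaa tau + imp S (alphaa tau) tau;
  alphap_ode : solves_ode tau T (fun t x => fp S x (mu t) t) alphap }.

Section Linearization.
Context (R : realType) (n m : nat) (S : hybrid_system R n m) (t0 tau T : R).
Context (N : nominal_trajectory S t0 tau T).

Definition Aa (t : R) : 'M[R]_n :=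
  Jac (fun x => fa S x (mu N t) t) (alphaa N t).
Definition Ap (t : R) : 'M[R]_n :=
  Jac (fun x => fp S x (mu N t) t) (alphap N t).
Definition Ba (t : R) : 'M[R]_(n, m) :=
  Jac (fun u => fa S (alphaa N t) u t) (mu N t).
Definition Bp (t : R) : 'M[R]_(n, m) :=
  Jac (fun u => fp S (alphap N t) u t) (mu N t).

Definition f_minus : 'cV[R]_n := fa S (alphaa N tau) (mu N tau) tau.
Definition f_plus : 'cV[R]_n := fp S (alphap N tau) (mu N tau) tau.
Definition D1imp : 'M[R]_n := Jac (fun x => imp S x tau) (alphaa N tau).
Definition D2imp : 'cV[R]_n := derive1 (imp S (alphaa N tau)) tau.
Definition D1ev : 'rV[R]_n := grad (fun x => ev S x tau) (alphaa N tau).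
Definition D2ev : R := derive1 (ev S (alphaa N tau)) tau.
Definition imp_dot : 'cV[R]_n := D1imp *m f_minus + D2imp.
Definition ev_dot : R := (D1ev *m f_minus) 0 0 + D2ev.

Definition jump_gain : 'M[R]_n :=
  (ev_dot^-1 *: (f_plus - f_minus - imp_dot)) *m D1ev + D1imp.

End Linearization.

Definition sym_posdef (R : realType) (k : nat) (M : 'M[R]_k) : Prop :=
  M^T = M /\ forall x : 'cV[R]_k, x != 0 -> 0 < (x^T *m M *m x) 0 0.

(* [W] is the input weight (R being the real numbers). *)
Section JumpLQ.
Context (R : realType) (n m : nat) (t0 tau T : R).
Context (Aa Ap : R -> 'M[R]_n) (Ba Bp : R -> 'M[R]_(n, m)) (H : 'M[R]_n).
Context (Q : R -> 'M[R]_n) (W : R -> 'M[R]_m) (PT : 'M[R]_n).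

Definition admissible (z0 : 'cV[R]_n) (z : R -> 'cV[R]_n)
    (v : R -> 'cV[R]_m) : Prop :=
  [/\ piecewise_continuous t0 T v,
      solves_jump_ode t0 tau T
        (fun t x => Aa t *m x + Ba t *m v t)
        (fun t x => Ap t *m x + Bp t *m v t)
        (fun zm zp => zp = zm + H *m zm) z &
      z t0 = z0].

Definition cost (z : R -> 'cV[R]_n) (v : R -> 'cV[R]_m) : R :=
  2^-1 * \int[@lebesgue_measure R]_(s in `[t0, T])
           (((z s)^T *m Q s *m z s) 0 0 + ((v s)^T *m W s *m v s) 0 0)
  + 2^-1 * ((z T)^T *m PT *m z T) 0 0.

Definition optimal (z0 : 'cV[R]_n) (z : R -> 'cV[R]_n)
    (v : R -> 'cV[R]_m) : Prop :=
  admissible z0 z v /\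
  forall z' v', admissible z0 z' v' -> cost z v <= cost z' v'.

Definition riccati_rhs (A : R -> 'M[R]_n) (B : R -> 'M[R]_(n, m))
    (t : R) (P : 'M[R]_n) : 'M[R]_n :=
  - ((A t)^T *m P + P *m A t
     - P *m B t *m invmx (W t) *m (B t)^T *m P + Q t).

Definition jump_riccati (P : R -> 'M[R]_n) : Prop :=
  P T = PT /\
  solves_jump_ode t0 tau T (riccati_rhs Aa Ba) (riccati_rhs Ap Bp)
    (fun Pm Pp => Pm = (1%:M + H)^T *m Pp *m (1%:M + H)) P.

(* The choice of branch at [tau] is immaterial. *)
Definition feedback_gain (P : R -> 'M[R]_n) (t : R) : 'M[R]_(m, n) :=
  invmx (W t) *m (if t < tau then Ba t else Bp t)^T *m P t.

End JumpLQ.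

(* Main.v *)
Require Import Defs.
From HB Require Import structures.
From mathcomp Require Import all_boot all_order all_algebra.
From mathcomp Require Import all_classical all_reals all_analysis.
From mathcomp Require Import ring lra.
Import Order.TTheory GRing.Theory Num.Theory.
Import numFieldNormedType.Exports.
Local Open Scope classical_set_scope.
Local Open Scope ring_scope.

(** Completing the square. Let [P] be symmetric and solve the Riccati equation
    on one phase, let [z' = A z + B v], and let [G t] be the running cost
    accumulated up to [t]. Then the derivative of [z^T P z + G] is [(v + K
    z)^T W (v + K z)] with [K = W^-1 B^T P] ([antiderivative_value]); it is
    nonnegative, and it vanishes exactly where the feedback law holds. The
    condition [P^- = (I + H)^T P^+ (I + H)] says that [z^T P z] is continuous
    across the jump [z^+ = (I + H) z^-], so the two phases add up: twice the
    cost is at least [z0^T P(t0) z0], with equality exactly under the feedback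
    law ([cost_value]). Optimality of the feedback then needs only that the
    closed loop has a solution, which is a linear equation with piecewise
    continuous coefficients ([feedback_admissible]).

    The Riccati equation is quadratic, so that global existence is not
    automatic. It is linearized: [P = L X^-1], where [(X, L)] solves the
    linear Hamiltonian system with terminal value [(I, P b)]
    ([hamiltonian_ex]). Global existence amounts to invertibility of [X]. If
    [X t c = 0], the function [c^T X^T L c] vanishes at [t], is nonincreasing
    because its derivative is [- (L c)^T S (L c) - (X c)^T Q (X c)] with [S =
    B W^-1 B^T], and is nonnegative at the terminal time; hence it is
    constant, so that [X c = 0] off a finite set of times after [t] and [c = X
    b c = 0] by continuity ([riccati_ex]). Only semidefiniteness of the
    terminal value can be used, since the jump condition produces a [P^-] that
    is singular whenever [I + H] is. Uniqueness holds since the difference of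
    two solutions satisfies a homogeneous linear equation ([riccati_unique]).

    All differential equations hold off a finite set of times. The analysis
    thus rests on two facts: a continuous function with nonnegative derivative
    off a finite set is nondecreasing ([antiderivative_ge0_le]), and a
    piecewise continuous function has an antiderivative in this sense, its
    integral ([antiderivative_integral]). Linear equations are then solved by
    Picard iteration in an exponentially weighted norm ([linear_ode_ex]). *)

Set Implicit Arguments.
Unset Strict Implicit.
Unset Printing Implicit Defensive.

(** * Limits and derivatives of matrix-valued functions *)

Section MatrixCalculus.
Context {R : realType}.

Lemma cvg_mxP (T : Type) (F : set_system T) {FF : Filter F} p q
    (f : T -> 'M[R]_(p, q)) (M : 'M[R]_(p, q)) :
  f x @[x --> F] --> M <-> forall i j, f x i j @[x --> F] --> M i j.
Proof.
split=> [fM i j|fM].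
  exact: (cvg_comp _ _ fM (@coord_continuous _ _ _ i j M)).
apply/cvgrPdist_le => e e0.
near=> x.
rewrite /Num.Def.normr/= mx_normrE (bigmax_le _ (ltW e0))//= => i _.
rewrite !mxE/=.
move: i; near: x; apply: filter_forall => /= i.
exact: ((cvgrPdist_le _ _).1 (fM i.1 i.2)).
Unshelve. all: by end_near. Qed.

Lemma is_derive_mxP p q (f : R -> 'M[R]_(p, q)) (t : R) (D : 'M[R]_(p, q)) :
  is_derive t 1 f D <-> forall i j, is_derive t 1 (fun x => f x i j) (D i j).
Proof.
split=> [fD i j|fD].
  have df : derivable f t 1 by [].
  apply: DeriveDef; first exact: (derivable_mxP f t 1).1.
  by rewrite -(@derive_val _ _ _ _ _ _ _ fD) derive_mx// mxE.
have df : derivable f t 1.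
  by apply/derivable_mxP => i j; have := fD i j; case.
apply: DeriveDef => //.
rewrite derive_mx//; apply/matrixP => i j; rewrite mxE.
exact: derive_val.
Qed.

Lemma is_derive_mulmx p q r (f : R -> 'M[R]_(p, q)) (g : R -> 'M[R]_(q, r))
    (t : R) df dg :
  is_derive t 1 f df -> is_derive t 1 g dg ->
  is_derive t 1 (fun x => f x *m g x) (df *m g t + f t *m dg).
Proof.
move=> /is_derive_mxP fD /is_derive_mxP gD; apply/is_derive_mxP => i j.
have -> : (fun x => (f x *m g x) i j) =
   \sum_(k < q) ((fun x => f x i k) \* (fun x => g x k j)).
  by apply/funext => x; rewrite mxE fct_sumE.
apply: is_derive_eq.
rewrite !mxE -big_split /=; apply: eq_bigr => k _.
by rewrite /GRing.scale /= addrC [g t k j * _]mulrC.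
Qed.

Lemma is_derive_trmx p q (f : R -> 'M[R]_(p, q)) (t : R) df :
  is_derive t 1 f df -> is_derive t 1 (fun x => (f x)^T) df^T.
Proof.
move=> /is_derive_mxP fD; apply/is_derive_mxP => i j; rewrite mxE.
by under eq_fun do rewrite mxE.
Qed.

Lemma cvg_mulmx (T : Type) (F : set_system T) {FF : Filter F} p q r
    (f : T -> 'M[R]_(p, q)) (g : T -> 'M[R]_(q, r))
    (M : 'M[R]_(p, q)) (N : 'M[R]_(q, r)) :
  f x @[x --> F] --> M -> g x @[x --> F] --> N ->
  f x *m g x @[x --> F] --> M *m N.
Proof.
move=> /cvg_mxP fM /cvg_mxP gN; apply/cvg_mxP => i j.
under eq_fun do rewrite mxE.
rewrite mxE; apply: cvg_big => [|k _]; first exact: add_continuous.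
exact: cvgM.
Qed.

Lemma cvg_trmx (T : Type) (F : set_system T) {FF : Filter F} p q
    (f : T -> 'M[R]_(p, q)) (M : 'M[R]_(p, q)) :
  f x @[x --> F] --> M -> (f x)^T @[x --> F] --> M^T.
Proof.
move=> /cvg_mxP fM; apply/cvg_mxP => i j.
under eq_fun do rewrite mxE.
by rewrite mxE; exact: fM.
Qed.

Lemma cvg_det (T : Type) (F : set_system T) {FF : Filter F} p
    (f : T -> 'M[R]_p) (M : 'M[R]_p) :
  f x @[x --> F] --> M -> \det (f x) @[x --> F] --> \det M.
Proof.
move=> /cvg_mxP fM; rewrite /determinant.
apply: cvg_big => [|s _]; first exact: add_continuous.
apply: cvgM; first exact: cvg_cst.
apply: cvg_big => [|i _]; first exact: mul_continuous.
exact: fM.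
Qed.

Lemma cvg_invmx (T : Type) (F : set_system T) {FF : Filter F} p
    (f : T -> 'M[R]_p) (M : 'M[R]_p) :
  M \in unitmx -> f x @[x --> F] --> M -> invmx (f x) @[x --> F] --> invmx M.
Proof.
move=> Mu fM; have dfM : \det (f x) @[x --> F] --> \det M by exact: cvg_det.
have dM0 : \det M != 0 by rewrite -unitfE -unitmxE.
have : (\det (f x))^-1 *: \adj (f x) @[x --> F] --> invmx M.
  rewrite /invmx Mu; apply: cvgZ; first exact: (cvgV dM0 dfM).
  apply/cvg_mxP => i j; under eq_fun do rewrite mxE.
  rewrite mxE; apply: cvgM; first exact: cvg_cst.
  apply: cvg_det; apply/cvg_mxP => k l; under eq_fun do rewrite !mxE.
  by rewrite !mxE; exact: ((cvg_mxP _ _).1 fM).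
apply: cvg_trans; apply: near_eq_cvg; near=> x.
rewrite /invmx; suff -> : f x \in unitmx by [].
rewrite unitmxE unitfE.
by near: x; apply: (cvgr_neq0 _ dfM).
Unshelve. all: by end_near. Qed.

(** The difference quotient of the inverse is
    [- f(t + h)^-1 (f(t + h) - f t) / h f(t)^-1]; continuity of the inverse, read
    off the adjugate formula, gives the limit. *)
Lemma is_derive_invmx p (f : R -> 'M[R]_p) (t : R) df :
  is_derive t 1 f df -> f t \in unitmx ->
  is_derive t 1 (fun x => invmx (f x)) (- (invmx (f t) *m df *m invmx (f t))).
Proof.
move=> fD fu.
have ft : f x @[x --> t] --> f t.
  by apply/differentiable_continuous/derivable1_diffP.
have shift_t : h *: 1 + t @[h --> 0^'] --> t.
  apply: cvg_trans (_ : h *: 1 + t @[h --> (0:R)] --> t).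
    by apply: cvg_app; exact: nbhs_dnbhs.
  rewrite -[X in _ --> X]add0r -[X in _ --> X + _](scale0r (1 : R)).
  apply: cvgD; last exact: cvg_cst.
  by apply: cvgZr_tmp; exact: cvg_id.
have fsu : \forall h \near 0^', f (h *: 1 + t) \in unitmx.
  have : \det (f (h *: 1 + t)) @[h --> 0^'] --> \det (f t).
    by apply: cvg_det; exact: cvg_comp shift_t ft.
  move=> /cvgr_neq0; rewrite -unitfE -unitmxE => /(_ fu).
  by apply: filterS => h; rewrite unitmxE unitfE.
have key : h^-1 *: (invmx (f (h *: 1 + t)) - invmx (f t)) @[h --> 0^'] -->
    - (invmx (f t) *m df *m invmx (f t)).
  have : - (invmx (f (h *: 1 + t)) *m (h^-1 *: (f (h *: 1 + t) - f t)) *m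
       invmx (f t)) @[h --> 0^'] --> - (invmx (f t) *m df *m invmx (f t)).
    apply: cvgN; apply: cvg_mulmx; last exact: cvg_cst.
    apply: cvg_mulmx.
      by apply: cvg_invmx => //; exact: cvg_comp shift_t ft.
    have [/cvg_ex[l fl] /= <-] := fD.
    suff -> : 'D_1 f t = l by [].
    exact/cvg_lim.
  apply: cvg_trans; apply: near_eq_cvg; near=> h.
  have hu : f (h *: 1 + t) \in unitmx by near: h.
  rewrite -scalemxAr -scalemxAl -scalerN; congr (_ *: _).
  by rewrite mulmxBr mulmxBl mulVmx// mul1mx mulmxK// opprB.
apply: DeriveDef; last exact/cvg_lim.
by apply/cvg_ex; exists (- (invmx (f t) *m df *m invmx (f t))).
Unshelve. all: by end_near. Qed.

End MatrixCalculus.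
(** * Antiderivatives off a finite set *)

Section Antiderivative.
Context {R : realType}.

Lemma within_continuous_cvg (U V : topologicalType) (A : set U) (f : U -> V) x :
  {within A, continuous f} -> A x -> f @ within A (nbhs x) --> f x.
Proof. by move=> /subspace_continuousP; exact. Qed.

Lemma sub_itvoo (a b c d : R) :
  a <= c -> d <= b -> {subset `]c, d[ <= `]a, b[}.
Proof. by move=> ac db; apply: subset_itv; rewrite bnd_simp. Qed.

(** A differential equation whose right-hand side has been evaluated along the
    solution. Any [solves_ode a b F x] is convertible to
    [antiderivative a b (fun t => F t (x t)) x], and is used in this form below. *)
Definition antiderivative (V : normedModType R) (a b : R) (f g : R -> V) :=
  solves_ode a b (fun t _ => f t) g.

Lemma antiderivative_eq (V : normedModType R) (a b : R) (f f' g g' : R -> V)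
    (s : seq R) :
  antiderivative a b f g ->
  (forall t, t \in `]a, b[ -> t \notin s -> f t = f' t) ->
  (forall t, t \in `[a, b] -> g t = g' t) ->
  antiderivative a b f' g'.
Proof.
move=> [gc [s0 gD]] ff' gg'; split.
  by apply: subspace_eq_continuous gc => t; rewrite inE; exact: gg'.
exists (s0 ++ s) => t tab; rewrite mem_cat negb_or => /andP[ts0 ts].
rewrite -ff'//; apply: near_eq_is_derive (gD t tab ts0).
have := near_in_itvoo tab; apply: filterS => u uab; apply: gg'.
exact: subset_itv_oo_cc uab.
Qed.

Lemma antiderivative_sub (V : normedModType R) (a b c d : R) (f g : R -> V) :
  antiderivative a b f g -> a <= c -> d <= b -> antiderivative c d f g.
Proof.
move=> [gc [s gD]] ac db; split.
  by apply: continuous_subspaceW gc; apply: subset_itv; rewrite bnd_simp.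
exists s => t tcd; apply: gD; exact: sub_itvoo tcd.
Qed.

Lemma antiderivative_cst (V : normedModType R) (a b : R) (c : V) :
  antiderivative a b (fun=> 0) (fun=> c).
Proof.
split; first by apply: continuous_subspaceT => x; exact: cvg_cst.
by exists [::] => t _ _; exact: is_derive_cst.
Qed.

Lemma antiderivativeD (V : normedModType R) (a b : R) (f g f' g' : R -> V) :
  antiderivative a b f g -> antiderivative a b f' g' ->
  antiderivative a b (fun t => f t + f' t) (fun t => g t + g' t).
Proof.
move=> [gc [s gD]] [gc' [s' gD']]; split.
  apply/subspace_continuousP => t tab.
  by apply: cvgD; [exact: (within_continuous_cvg gc)|exact: (within_continuous_cvg gc')].
exists (s ++ s') => t tab; rewrite mem_cat negb_or => /andP[ts ts'].
exact: is_deriveD (gD t tab ts) (gD' t tab ts').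
Qed.

Lemma antiderivativeN (V : normedModType R) (a b : R) (f g : R -> V) :
  antiderivative a b f g ->
  antiderivative a b (fun t => - f t) (fun t => - g t).
Proof.
move=> [gc [s gD]]; split.
  by apply/subspace_continuousP => t tab; apply: cvgN; exact: (within_continuous_cvg gc).
by exists s => t tab ts; exact: is_deriveN (gD t tab ts).
Qed.

Lemma antiderivative_mxP p q (a b : R) (f g : R -> 'M[R]_(p, q)) :
  antiderivative a b f g <->
  forall i j, antiderivative a b (fun t => f t i j) (fun t => g t i j).
Proof.
split=> [[gc [s gD]] i j|fg].
  split; last by exists s => t tab ts; exact: ((is_derive_mxP _ _ _).1 (gD t tab ts)).
  apply/subspace_continuousP => t tab.
  exact: ((cvg_mxP _ _).1 (within_continuous_cvg gc tab)).
split.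
  apply/subspace_continuousP => t tab; apply/cvg_mxP => i j.
  by have [gc _] := fg i j; exact: (within_continuous_cvg gc).
have /choice[s gD] : forall ij : 'I_p * 'I_q, exists s : seq R,
    forall t, t \in `]a, b[ -> t \notin s ->
    is_derive t 1 (fun t => g t ij.1 ij.2) (f t ij.1 ij.2).
  by move=> ij; have [_] := fg ij.1 ij.2.
exists (flatten [seq s ij | ij : 'I_p * 'I_q]) => t tab ts.
apply/is_derive_mxP => i j; apply: (gD (i, j)) => //.
apply: contra ts => ts; apply/flattenP; exists (s (i, j)) => //.
by apply: map_f; rewrite mem_enum.
Qed.

Lemma antiderivative_mulmx p q r (a b : R) (f g : R -> 'M[R]_(p, q))
    (f' g' : R -> 'M[R]_(q, r)) :
  antiderivative a b f g -> antiderivative a b f' g' ->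
  antiderivative a b (fun t => f t *m g' t + g t *m f' t)
    (fun t => g t *m g' t).
Proof.
move=> [gc [s gD]] [gc' [s' gD']]; split.
  apply/subspace_continuousP => t tab; apply: cvg_mulmx.
    exact: (within_continuous_cvg gc).
  exact: (within_continuous_cvg gc').
exists (s ++ s') => t tab; rewrite mem_cat negb_or => /andP[ts ts'].
exact: is_derive_mulmx (gD t tab ts) (gD' t tab ts').
Qed.

Lemma antiderivative_trmx p q (a b : R) (f g : R -> 'M[R]_(p, q)) :
  antiderivative a b f g ->
  antiderivative a b (fun t => (f t)^T) (fun t => (g t)^T).
Proof.
move=> /antiderivative_mxP fg; apply/antiderivative_mxP => i j.
by apply: (antiderivative_eq (s := [::]) (fg j i)) => t *; rewrite mxE.
Qed.

Lemma antiderivative_invmx p (a b : R) (f g : R -> 'M[R]_p) :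
  antiderivative a b f g -> (forall t, t \in `[a, b] -> g t \in unitmx) ->
  antiderivative a b (fun t => - (invmx (g t) *m f t *m invmx (g t)))
    (fun t => invmx (g t)).
Proof.
move=> [gc [s gD]] gu; split.
  apply/subspace_continuousP => t tab; apply: cvg_invmx; first exact: gu.
  exact: (within_continuous_cvg gc).
exists s => t tab ts; apply: is_derive_invmx (gD t tab ts) _.
exact/gu/subset_itv_oo_cc.
Qed.

(** Induction on the exceptional points: cut the interval at one of them, and use
    the mean value theorem on intervals that contain none. *)
Lemma antiderivative_ge0_le (a b : R) (f g : R -> R) (s : seq R) :
  a <= b -> antiderivative a b f g ->
  (forall t, t \in `]a, b[ -> t \notin s -> 0 <= f t) -> g a <= g b.
Proof.
move=> ab [gc [s' gD]] f0.
have {gD f0} : forall t, t \in `]a, b[ -> t \notin s ++ s' ->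
    is_derive t 1 g (f t) /\ 0 <= f t.
  move=> t tab; rewrite mem_cat negb_or => /andP[ts ts'].
  by split; [exact: gD|exact: f0].
elim: (s ++ s') a b ab gc => {s s'} [|c s IH] a b ab gc fg.
  (* The mean value theorem may return an end point, where the sign of [f] is
     unknown; the positive part of [f] is the same derivative inside. *)
  have [|c _ gba] := @MVT_segment R g (fun t => Num.max 0 (f t)) a b ab _ gc.
    by move=> t tab; have [gD f0] := fg t tab isT; rewrite max_r.
  rewrite -subr_ge0 gba mulr_ge0// ?subr_ge0//.
  by rewrite le_max lexx.
have [cab|cab] := boolP (c \in `]a, b[); last first.
  apply: IH => // t tab ts; apply: fg => //; rewrite in_cons negb_or ts andbT.
  by apply: contraNneq cab => <-.
move: (cab); rewrite in_itv/= => /andP[ac cb].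
apply: (@le_trans _ _ (g c)); apply: IH; rewrite ?ltW//.
- by apply: continuous_subspaceW gc; apply: subset_itv; rewrite bnd_simp// ltW.
- move=> t tac ts; apply: fg.
    by apply: sub_itvoo tac => //; exact: ltW.
  rewrite in_cons negb_or ts andbT.
  by move: tac; rewrite in_itv/= => /andP[_ /lt_eqF ->].
- by apply: continuous_subspaceW gc; apply: subset_itv; rewrite bnd_simp// ltW.
- move=> t tac ts; apply: fg.
    by apply: sub_itvoo tac => //; exact: ltW.
  rewrite in_cons negb_or ts andbT.
  by move: tac; rewrite in_itv/= => /andP[/gt_eqF -> _].
Qed.

(** Differential inequality that replaces the estimate of an integral by the
    integral of a bound: both [k + g] and [k - g] are nondecreasing. *)
Lemma antiderivative_norm_le (a b : R) (f g h k : R -> R) (s : seq R) :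
  a <= b -> antiderivative a b f g -> antiderivative a b h k ->
  (forall t, t \in `]a, b[ -> t \notin s -> `|f t| <= h t) ->
  `|g a| <= k a -> `|g b| <= k b.
Proof.
move=> ab fg hk fh; rewrite !ler_norml => /andP[ka1 ka2].
have kg : k a + g a <= k b + g b.
  apply: (antiderivative_ge0_le (s := s) ab (antiderivativeD hk fg)) => t tab ts.
  by have := fh t tab ts; rewrite ler_norml => /andP[]; lra.
have kNg : k a - g a <= k b - g b.
  apply: (antiderivative_ge0_le (s := s) ab
    (antiderivativeD hk (antiderivativeN fg))) => t tab ts.
  by have := fh t tab ts; rewrite ler_norml => /andP[]; lra.
by apply/andP; split; lra.
Qed.

(** A nondecreasing function with equal end values is constant, so its
    derivative vanishes wherever it is known. *)
Lemma antiderivative_ge0_eq0 (a b : R) (f g : R -> R) (s : seq R) :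
  a <= b -> antiderivative a b f g ->
  (forall t, t \in `]a, b[ -> t \notin s -> 0 <= f t) -> g b <= g a ->
  exists s' : seq R, forall t, t \in `]a, b[ -> t \notin s' -> f t = 0.
Proof.
move=> ab fg f0 gba.
have le_g x y : a <= x -> x <= y -> y <= b -> g x <= g y.
  move=> ax xy yb.
  apply: (antiderivative_ge0_le (s := s) xy (antiderivative_sub fg ax yb)) => t txy.
  by apply: f0; exact: sub_itvoo txy.
have [_ [s' gD]] := fg; exists s' => t tab ts.
have {}gD := gD t tab ts.
have g0 : is_derive t 1 g 0.
  apply: (@near_eq_is_derive _ _ _ (cst (g a))).
  have := near_in_itvoo tab; apply: filterS => u.
  rewrite in_itv/= => /andP[/ltW au /ltW ub].
  apply/eqP; rewrite eq_le /cst le_g//= (le_trans _ gba)//.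
  exact: le_g.
by rewrite -(@derive_val _ _ _ _ _ _ _ gD) (@derive_val _ _ _ _ _ _ _ g0).
Qed.

Lemma antiderivative0_cst p q (a b : R) (g : R -> 'M[R]_(p, q)) :
  antiderivative a b (fun=> 0) g ->
  forall x y, x \in `[a, b] -> y \in `[a, b] -> g x = g y.
Proof.
move=> g0.
suff gab x : x \in `[a, b] -> g x = g a by move=> x y xab yab; rewrite !gab.
rewrite in_itv/= => /andP[ax xb]; apply/matrixP => i j; apply/eqP.
have {}g0 := antiderivative_sub ((antiderivative_mxP _ _ _ _).1 g0 i j) (lexx a) xb.
rewrite eq_le; apply/andP; split.
  rewrite -lerN2.
  apply: (antiderivative_ge0_le (s := [::]) ax (antiderivativeN g0)) => t _ _.
  by rewrite mxE oppr0.
by apply: (antiderivative_ge0_le (s := [::]) ax g0) => t _ _; rewrite mxE.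
Qed.

End Antiderivative.

(** * Piecewise continuous functions *)

Section PiecewiseContinuous.
Context {R : realType}.

Lemma piecewise_continuous_within (V : normedModType R) (a b : R) (f : R -> V) :
  {within `[a, b], continuous f} -> piecewise_continuous a b f.
Proof.
move=> /subspace_continuousP fc.
have lim (F : set_system R) (FF : Filter F) t : t \in `[a, b] ->
    F --> t -> (\forall u \near F, u \in `[a, b]) -> f @ F --> f t.
  move=> tab Ft Fab; apply: (cvg_trans _ (fc t tab)) => A /= tA.
  have := Ft _ tA; apply: filterS2 Fab => u uab; exact.
split.
- exists [::] => t tab _; apply: lim; first exact: subset_itv_oo_cc.
    exact: cvg_id.
  by apply: filterS (near_in_itvoo tab); exact: subset_itv_oo_cc.
- move=> t tab; exists (f t); apply: lim; first exact: subset_itv_co_cc.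
    exact: cvg_within.
  move: tab; rewrite in_itv/= => /andP[at_ tb]; near=> u.
  rewrite in_itv/=; apply/andP; split; last first.
    by near: u; exact: nbhs_right_le.
  by apply: (le_trans at_); near: u; exact: nbhs_right_ge.
- move=> t tab; exists (f t); apply: lim; first exact: subset_itv_oc_cc.
    exact: cvg_within.
  move: tab; rewrite in_itv/= => /andP[at_ tb]; near=> u.
  rewrite in_itv/=; apply/andP; split.
    by near: u; exact: nbhs_left_ge.
  by apply: (le_trans _ tb); near: u; exact: nbhs_left_le.
Unshelve. all: by end_near. Qed.

Lemma piecewise_continuous_comp (U V : normedModType R) (a b : R)
    (h : U -> V) (f : R -> U) :
  continuous h -> piecewise_continuous a b f ->
  piecewise_continuous a b (fun t => h (f t)).
Proof.
move=> hc [[s fs] fr fl]; split.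
- by exists s => t tab ts; apply: continuous_comp; [exact: fs|exact: hc].
- by move=> t /fr[l tl]; exists (h l); apply: continuous_cvg tl; exact: hc.
- by move=> t /fl[l tl]; exists (h l); apply: continuous_cvg tl; exact: hc.
Qed.

Lemma piecewise_continuous_pair (U V : normedModType R) (a b : R)
    (f : R -> U) (g : R -> V) :
  piecewise_continuous a b f -> piecewise_continuous a b g ->
  piecewise_continuous a b (fun t => (f t, g t)).
Proof.
move=> [[s fs] fr fl] [[s' gs] gr gl]; split.
- exists (s ++ s') => t tab; rewrite mem_cat negb_or => /andP[ts ts'].
  exact: cvg_pair (fs t tab ts) (gs t tab ts').
- move=> t tab; have [l tl] := fr t tab; have [k tk] := gr t tab.
  by exists (l, k); exact: cvg_pair tl tk.
- move=> t tab; have [l tl] := fl t tab; have [k tk] := gl t tab.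
  by exists (l, k); exact: cvg_pair tl tk.
Qed.

Lemma piecewise_continuous_glue (V : normedModType R) (a c b : R)
    (f g h : R -> V) :
  a <= c -> c <= b ->
  piecewise_continuous a c f -> piecewise_continuous c b g ->
  {in `]a, c[, h =1 f} -> {in `]c, b[, h =1 g} -> piecewise_continuous a b h.
Proof.
move=> ac cb [[s fs] fr fl] [[s' gs] gr gl] hf hg.
have hfn t : t \in `]a, c[ -> {near t, h =1 f}.
  by move=> /near_in_itvoo; apply: filterS => u; exact: hf.
have hgn t : t \in `]c, b[ -> {near t, h =1 g}.
  by move=> /near_in_itvoo; apply: filterS => u; exact: hg.
split.
- exists (c :: s ++ s') => t; rewrite in_itv/= => /andP[at_ tb].
  rewrite in_cons mem_cat !negb_or => /and3P[tc ts ts'].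
  have [ct|ct|] := ltgtP c t; last by move=> ct; rewrite ct eqxx in tc.
    have tcb : t \in `]c, b[ by rewrite in_itv/= ct.
    have : g u @[u --> t] --> g t by exact: gs.
    rewrite -(hg t tcb).
    by apply: cvg_trans; apply: near_eq_cvg; have := hgn t tcb; apply: filterS => u ->.
  have tac : t \in `]a, c[ by rewrite in_itv/= at_.
  have : f u @[u --> t] --> f t by exact: fs.
  rewrite -(hf t tac).
  by apply: cvg_trans; apply: near_eq_cvg; have := hfn t tac; apply: filterS => u ->.
- move=> t; rewrite in_itv/= => /andP[at_ tb].
  have [ct|ct] := leP c t.
    have [|l tl] := gr t; first by rewrite in_itv/= ct.
    exists l; move: tl; apply: cvg_trans; apply: near_eq_cvg; near=> u.
    by rewrite hg// in_itv/=; apply/andP; split; [apply: (le_lt_trans ct)|];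
      near: u; [exact: nbhs_right_gt|exact: nbhs_right_lt].
  have [|l tl] := fr t; first by rewrite in_itv/= at_.
  exists l; move: tl; apply: cvg_trans; apply: near_eq_cvg; near=> u.
  by rewrite hf// in_itv/=; apply/andP; split; [apply: (le_lt_trans at_)|];
      near: u; [exact: nbhs_right_gt|exact: nbhs_right_lt].
- move=> t; rewrite in_itv/= => /andP[at_ tb].
  have [tc|ct] := leP t c.
    have [|l tl] := fl t; first by rewrite in_itv/= at_.
    exists l; move: tl; apply: cvg_trans; apply: near_eq_cvg; near=> u.
    by rewrite hf// in_itv/=; apply/andP; split; [|apply: (lt_le_trans _ tc)];
      near: u; [exact: nbhs_left_gt|exact: nbhs_left_lt].
  have [|l tl] := gl t; first by rewrite in_itv/= ct.
  exists l; move: tl; apply: cvg_trans; apply: near_eq_cvg; near=> u.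
  by rewrite hg// in_itv/=; apply/andP; split; [|apply: (lt_le_trans _ tb)];
      near: u; [exact: nbhs_left_gt|exact: nbhs_left_lt].
Unshelve. all: by end_near. Qed.

Lemma piecewise_continuous_sub (V : normedModType R) (a b c d : R) (f : R -> V) :
  piecewise_continuous a b f -> a <= c -> d <= b -> piecewise_continuous c d f.
Proof.
move=> [[s fs] fr fl] ac db; split.
- by exists s => t tcd; apply: fs; exact: sub_itvoo tcd.
- move=> t; rewrite in_itv/= => /andP[ct td]; apply: fr.
  by rewrite in_itv/= (le_trans ac)//= (lt_le_trans td).
- move=> t; rewrite in_itv/= => /andP[ct td]; apply: fl.
  by rewrite in_itv/= (le_lt_trans ac)//= (le_trans td).
Qed.

Lemma piecewise_continuousD (V : normedModType R) (a b : R) (f g : R -> V) :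
  piecewise_continuous a b f -> piecewise_continuous a b g ->
  piecewise_continuous a b (fun t => f t + g t).
Proof.
move=> fc gc; apply: (piecewise_continuous_comp (f := fun t => (f t, g t))
  (h := fun p : V * V => p.1 + p.2)).
  exact: add_continuous.
exact: piecewise_continuous_pair.
Qed.

Lemma piecewise_continuousN (V : normedModType R) (a b : R) (f : R -> V) :
  piecewise_continuous a b f -> piecewise_continuous a b (fun t => - f t).
Proof. by apply: piecewise_continuous_comp; exact: opp_continuous. Qed.

Lemma piecewise_continuous_mulmx p q r (a b : R)
    (f : R -> 'M[R]_(p, q)) (g : R -> 'M[R]_(q, r)) :
  piecewise_continuous a b f -> piecewise_continuous a b g ->
  piecewise_continuous a b (fun t => f t *m g t).
Proof.
move=> fc gc; apply: (piecewise_continuous_comp (f := fun t => (f t, g t))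
  (h := fun p : 'M[R]_(p, q) * 'M[R]_(q, r) => p.1 *m p.2)).
  by move=> x; apply: cvg_mulmx; [exact: cvg_fst|exact: cvg_snd].
exact: piecewise_continuous_pair.
Qed.

Lemma piecewise_continuous_trmx p q (a b : R) (f : R -> 'M[R]_(p, q)) :
  piecewise_continuous a b f -> piecewise_continuous a b (fun t => (f t)^T).
Proof.
by apply: piecewise_continuous_comp => x; apply: (@cvg_trmx R _ (nbhs x)); exact: cvg_id.
Qed.

Lemma piecewise_continuous_entry p q (a b : R) (f : R -> 'M[R]_(p, q)) i j :
  piecewise_continuous a b f -> piecewise_continuous a b (fun t => f t i j).
Proof.
apply: (piecewise_continuous_comp (h := fun M : 'M[R]_(p, q) => M i j)).
exact: (@coord_continuous _ _ _ i j).
Qed.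

(** One-sided limits make the function bounded near each point, and the
    segment is compact. *)
Lemma piecewise_continuous_bounded (V : normedModType R) (a b : R) (f : R -> V) :
  piecewise_continuous a b f ->
  exists2 K, 0 <= K & forall t, t \in `[a, b] -> `|f t| <= K.
Proof.
move=> [_ fr fl].
have loc t : t \in `[a, b] ->
    exists K, \forall u \near t, u \in `[a, b] -> `|f u| <= K.
  rewrite in_itv/= => /andP[at_ tb].
  have [Kl Hl] : exists K, \forall u \near t, u < t -> u \in `[a, b] -> `|f u| <= K.
    have [at1|] := ltP a t; last first.
      move=> ta; exists 0; near=> u => ut; rewrite in_itv/= => /andP[au _].
      by have := le_lt_trans au ut; rewrite ltNge ta.
    have [|l tl] := fl t; first by rewrite in_itv/= at1.
    exists (`|l| + 1).
    have : \forall u \near t^'-, `|f u| <= `|l| + 1.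
      by apply: (@cvgr_norm_le R V R (t^'-) _ f l tl); rewrite ltrDl.
    move=> H; have {}H : \forall u \near t, u < t -> `|f u| <= `|l| + 1 by exact: H.
    by apply: filterS H => u + ut _; apply.
  have [Kr Hr] : exists K, \forall u \near t, t < u -> u \in `[a, b] -> `|f u| <= K.
    have [at1|] := ltP t b; last first.
      move=> ta; exists 0; near=> u => ut; rewrite in_itv/= => /andP[_ ub].
      by have := lt_le_trans ut ub; rewrite ltNge ta.
    have [|l tl] := fr t; first by rewrite in_itv/= at_.
    exists (`|l| + 1).
    have : \forall u \near t^'+, `|f u| <= `|l| + 1.
      by apply: (@cvgr_norm_le R V R (t^'+) _ f l tl); rewrite ltrDl.
    move=> H; have {}H : \forall u \near t, t < u -> `|f u| <= `|l| + 1 by exact: H.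
    by apply: filterS H => u + ut _; apply.
  exists (Num.max `|f t| (Num.max Kl Kr)); move: Hl Hr; apply: filterS2 => u Hl Hr uab.
  rewrite !le_max; have [ut|tu|->] := ltgtP u t; last by rewrite lexx.
    by rewrite Hl// orbT.
  by rewrite Hr// !orbT.
have : near_covering `[a, b]%classic by apply/compact_near_coveringP; exact: segment_compact.
move=> /(_ R +oo (fun K u => u \in `[a, b] -> `|f u| <= K) _).
case => [t /= tab|M [Mr HM]].
  have [K HK] := loc t tab.
  exists ([set u | u \in `[a, b] -> `|f u| <= K], [set M | K <= M]) => /=.
    split=> //; apply: nbhs_pinfty_ge; exact: num_real.
  by move=> [u M] /= [Hu KM] uab; exact: le_trans (Hu uab) KM.
exists (Num.max 0 (M + 1)) => [|t tab]; first by rewrite le_max lexx.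
have M1 : M < M + 1 by rewrite ltrDl.
by rewrite le_max (HM _ M1 t tab tab) orbT.
Unshelve. all: by end_near. Qed.

Lemma near_notin (t : R) (s : seq R) : t \notin s -> \forall u \near t, u \notin s.
Proof.
elim: s => [|c s IH]; first by move=> _; near=> u.
rewrite in_cons negb_or => /andP[tc ts]; near=> u.
rewrite in_cons negb_or; apply/andP; split; last by near: u; exact: IH.
rewrite -subr_eq0; near: u.
apply: (@cvgr_neq0 _ R _ (nbhs t) _ (fun u => u - c) (t - c)).
  by apply: cvgB; [exact: cvg_id|exact: cvg_cst].
by rewrite subr_eq0.
Unshelve. all: by end_near. Qed.

Lemma near_left_notin (x : R) (s : seq R) : \forall u \near x^'-, u \notin s.
Proof.
have xs : x \notin [seq u <- s | u != x] by rewrite mem_filter eqxx.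
near=> u.
have ux : u < x by near: u; exact: nbhs_left_lt.
have : u \notin [seq u <- s | u != x].
  by near: u; apply: (cvg_within (F := nbhs x)); exact: near_notin.
by rewrite mem_filter (lt_eqF ux).
Unshelve. all: by end_near. Qed.

Lemma measurable_fun_seq (s : seq R) (f : R -> R) :
  measurable ([set` s] : set R) /\ measurable_fun [set` s] f.
Proof.
elim: s => [|c s [ms mf]].
  by rewrite set_nil; split; [exact: measurable0|exact: measurable_fun_set0].
rewrite (_ : [set` c :: s] = c |` [set` s]); last first.
  by apply/seteqP; split=> x /=; rewrite in_cons => /predU1P.
 split; first exact: measurableU.
by apply/measurable_funU => //; split => //; exact: measurable_fun_set1.
Qed.

Lemma piecewise_continuous_integrable (a b : R) (f : R -> R) :
  piecewise_continuous a b f ->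
  (@lebesgue_measure R).-integrable `[a, b] (EFin \o f).
Proof.
move=> fc; have [K K0 fK] := piecewise_continuous_bounded fc.
apply: measurable_bounded_integrable.
- exact: measurable_itv.
- by rewrite /= lebesgue_measure_itv; case: ifP => _; rewrite ltry.
- have [[s fs] _ _] := fc.
  pose O : set R := fun t => (t \in `]a, b[) /\ (t \notin s).
  have oO : open O.
    rewrite openE => t [tab ts]; rewrite /interior.
    by apply: filterI; [exact: near_in_itvoo|exact: near_notin].
  have mO : measurable O by exact: measurable_realfun.open_measurable.
  have [ms mf] := measurable_fun_seq (a :: b :: s) f.
  apply: (measurable_funS (E := O `|` [set` a :: b :: s])).
  + exact: measurableU.
  + move=> t /=; rewrite in_itv/= => /andP[at_ tb].
    have [ts|ts] := boolP (t \in a :: b :: s); [by right|left].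
    move: ts; rewrite !in_cons !negb_or => /and3P[ta tb' ts].
    by split => //; rewrite in_itv/= !lt_neqAle at_ tb tb' eq_sym ta.
  + apply/measurable_funU => //; split=> //.
    apply: measurable_realfun.open_continuous_measurable_fun => // t; rewrite inE => -[tab ts].
    exact: fs.
- exists K; split; first exact: num_real.
  by move=> M KM t tab; apply: le_trans (fK t tab) (ltW KM).
Qed.

Lemma antiderivative_integral (a b : R) (f : R -> R) :
  a <= b -> piecewise_continuous a b f ->
  antiderivative a b f
    (fun t => \int[@lebesgue_measure R]_(u in `[a, t]) f u).
Proof.
move=> ab fc; have fi := piecewise_continuous_integrable fc.
split; first exact: parameterized_integral_continuous.
have [[s fs] _ _] := fc; exists s => t tab ts.
move: (tab); rewrite in_itv/= => /andP[at_ tb].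
have [|dF eF] := continuous_FTC1 tb fi _ (fs t tab ts); first by rewrite lte_fin.
by apply: DeriveDef => //; rewrite -derive1E.
Qed.

Lemma antiderivative_mx_ex p q (a b : R) (f : R -> 'M[R]_(p, q)) :
  a <= b -> piecewise_continuous a b f ->
  exists2 g : R -> 'M[R]_(p, q), antiderivative a b f g & g a = 0.
Proof.
move=> ab fc.
exists (fun t => \matrix_(i, j) \int[@lebesgue_measure R]_(u in `[a, t]) f u i j).
  apply/antiderivative_mxP => i j.
  apply: (antiderivative_eq (s := [::])
    (antiderivative_integral ab (piecewise_continuous_entry i j fc))) => //.
  by move=> t _; rewrite mxE.
by apply/matrixP => i j; rewrite !mxE set_itv1 Rintegral_set1.
Qed.

End PiecewiseContinuous.

(** * Linear equations with piecewise continuous coefficients *)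

Section LinearODE.
Context {R : realType}.

(** Nested intervals: [u k - 2 E / 2^k] is nondecreasing, [u k + 2 E / 2^k] is
    nonincreasing, so the supremum of the former works for all [k] at once. *)
Lemma geometric_limit (E : R) (u : nat -> R) :
  (forall k, `|u k.+1 - u k| <= E * 2^-1 ^+ k) ->
  exists l, forall k, `|l - u k| <= 2 * E * 2^-1 ^+ k.
Proof.
move=> uE; pose r k := 2 * E * 2^-1 ^+ k.
have step k : u k - r k <= u k.+1 - r k.+1 /\ u k.+1 + r k.+1 <= u k + r k.
  have := uE k; rewrite ler_norml /r exprS => /andP[].
  by set z := 2^-1 ^+ k; lra.
have r0 k : 0 <= r k.
  rewrite /r mulr_ge0 ?exprn_ge0// mulr_ge0//.
  by have := le_trans (normr_ge0 _) (uE 0); rewrite expr0 mulr1.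
have lo j k : (j <= k)%N -> u j - r j <= u k - r k.
  move=> /subnK <-; elim: (k - j)%N => // n IH.
  by rewrite addSn (le_trans IH)//; exact: (step _).1.
have up j k : (j <= k)%N -> u k + r k <= u j + r j.
  move=> /subnK <-; elim: (k - j)%N => // n IH.
  by rewrite addSn (le_trans _ IH)//; exact: (step _).2.
have lu j k : u j - r j <= u k + r k.
  have [jk|/ltnW kj] := leqP j k.
    by apply: le_trans (lo _ _ jk) _; have := r0 k; lra.
  by apply: le_trans _ (up _ _ kj); have := r0 j; lra.
exists (sup (range (fun k => u k - r k))) => k.
rewrite ler_distl; apply/andP; split.
  apply: ub_le_sup; last by exists k.
  by exists (u 0 + r 0) => _ [j _ <-].
by apply: ge_sup => [|_ [j _ <-]]; [exists (u 0 - r 0); exists 0|exact: lu].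
Qed.

Lemma geometric_small (A e : R) : 0 < e -> exists k, A * 2^-1 ^+ k <= e.
Proof.
move=> e0.
have : A * 2^-1 ^+ k @[k --> \oo] --> A * 0.
  apply: cvgM; first exact: cvg_cst.
  by apply: cvg_expr; rewrite ger0_norm ?invr_ge0// invf_lt1// ltr1n.
rewrite mulr0 => /cvgrPdist_le/(_ e e0)[k _ /(_ k (leqnn k))].
by rewrite sub0r normrN => /(le_trans (ler_norm _)) => ke; exists k.
Qed.

Lemma le_geometric_le0 (A x : R) : (forall k, x <= A * 2^-1 ^+ k) -> x <= 0.
Proof.
move=> xA; apply/ler_addgt0Pr => e e0; rewrite add0r.
by have [k] := geometric_small A e0; apply: le_trans.
Qed.

Lemma entry_le_norm p q (M : 'M[R]_(p, q)) i j : `|M i j| <= `|M|.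
Proof.
rewrite [leRHS]/Num.Def.normr/= mx_normrE.
exact: (le_bigmax _ (fun ij => `|M ij.1 ij.2|) (i, j)).
Qed.

Lemma mulmx_entry_le p q r (M : 'M[R]_(p, q)) (N : 'M[R]_(q, r)) c d i j :
  `|M| <= c -> (forall k l, `|N k l| <= d) -> `|(M *m N) i j| <= q%:R * c * d.
Proof.
move=> Mc Nd; rewrite mxE; apply: le_trans (ler_norm_sum _ _ _) _.
apply: (@le_trans _ _ (\sum_(k < q) c * d)); last first.
  by rewrite sumr_const card_ord -mulrA mulr_natl.
apply: ler_sum => k _; rewrite normrM ler_pM//.
exact: le_trans (entry_le_norm _ _ _) Mc.
Qed.

Lemma antiderivative_exp (a b c k : R) :
  antiderivative a b (fun t => c * (k * expR (k * (t - a))))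
    (fun t => c * expR (k * (t - a))).
Proof.
have eD (t : R) : is_derive t 1 (fun t : R => c * expR (k * (t - a)))
    (c * (k * expR (k * (t - a)))).
  have h1 : is_derive t 1 (fun t : R => k * (t - a)) k.
    by apply: is_derive_eq; rewrite /GRing.scale/=; ring.
  have h2 := @is_derive1_comp R expR (fun t : R => k * (t - a)) t _ _
    (is_derive_expR _) h1.
  by apply: is_derive_eq; rewrite /GRing.scale/=; ring.
split; last by exists [::] => t _ _; exact: eD.
apply: continuous_subspaceT => t.
apply: differentiable_continuous; apply/derivable1_diffP.
by have [] := eD t.
Qed.

Lemma antiderivative_linear (a b c : R) :
  antiderivative a b (fun=> c) (fun t => c * (t - a)).
Proof.
have eD (t : R) : is_derive t 1 (fun t : R => c * (t - a)) c.
  by apply: is_derive_eq; rewrite /GRing.scale/=; ring.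
split; last by exists [::] => t _ _; exact: eD.
apply: continuous_subspaceT => t.
apply: differentiable_continuous; apply/derivable1_diffP.
by have [] := eD t.
Qed.

(** Picard iteration. If all entries of [M] are bounded by [m] and [K = p m],
    the successive differences satisfy
    [|y (k+1) - y k| <= C 2^-k exp (2 K (t - a))]: integrating [M] against this
    bound multiplies it by [K / (2 K) = 1 / 2]. The weight thus gives geometric
    convergence on the whole segment, however long it is. *)
Lemma linear_ode_ex p q (a b : R) (M : R -> 'M[R]_p) (Y0 : 'M[R]_(p, q)) :
  a <= b -> piecewise_continuous a b M ->
  exists2 Y, antiderivative a b (fun t => M t *m Y t) Y & Y a = Y0.
Proof.
move=> ab Mc.
have [m m0 Mm] := piecewise_continuous_bounded Mc.
pose K := p%:R * m; have K0 : 0 <= K by rewrite mulr_ge0.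
have MD t (D : 'M[R]_(p, q)) d i j : t \in `]a, b[ ->
    (forall k l, `|D k l| <= d) -> `|(M t *m D) i j| <= K * d.
  by move=> tab; apply: mulmx_entry_le; apply: Mm; exact: subset_itv_oo_cc.
have /choice[Phi PhiP] : forall f : R -> 'M[R]_(p, q), exists g,
    {within `[a, b], continuous f} ->
    antiderivative a b (fun t => M t *m f t) g /\ g a = Y0.
  move=> f; have [fc|nfc] := pselect {within `[a, b], continuous f}; last by exists f.
  have [g fg ga] := antiderivative_mx_ex ab
    (piecewise_continuous_mulmx Mc (piecewise_continuous_within fc)).
  exists (fun t => g t + Y0) => _; split; last by rewrite ga add0r.
  apply: (antiderivative_eq (s := [::])
    (antiderivativeD fg (antiderivative_cst a b Y0))) => // t _ _.
  by rewrite addr0.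
pose y k := iter k Phi (fun=> Y0).
have yc k : {within `[a, b], continuous (y k)}.
  elim: k => [|k IH]; first by apply: continuous_subspaceT => x; exact: cvg_cst.
  by have [[]] := PhiP _ IH.
have yA k : antiderivative a b (fun t => M t *m y k t) (y k.+1).
  by have [] := PhiP _ (yc k).
have ya k : y k a = Y0 by case: k => // k; have [] := PhiP _ (yc k).
have [C C0 y1C] : exists2 C, 0 <= C & forall t i j, t \in `[a, b] ->
    `|y 1 t i j - y 0 t i j| <= C.
  have [C C0 yC] := piecewise_continuous_bounded (piecewise_continuousD
    (piecewise_continuous_within (yc 1))
    (piecewise_continuousN (piecewise_continuous_within (yc 0)))).
  exists C => // t i j tab; apply: le_trans (yC t tab).
  by apply: le_trans (entry_le_norm _ i j); rewrite !mxE.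
have yd k t i j : t \in `[a, b] ->
    `|y k.+1 t i j - y k t i j| <= C * 2^-1 ^+ k * expR (2 * K * (t - a)).
  elim: k t i j => [|k IH] t i j tab.
    rewrite expr0 mulr1; apply: le_trans (y1C t i j tab) _.
    rewrite ler_peMr// -expR0 ler_expR mulr_ge0 ?mulr_ge0//.
    by move: tab; rewrite in_itv/= subr_ge0 => /andP[].
  move: (tab); rewrite in_itv/= => /andP[at_ tb].
  have yy := (antiderivative_mxP _ _ _ _).1
    (antiderivativeD (yA k.+1) (antiderivativeN (yA k))) i j.
  suff: `|(y k.+2 t - y k.+1 t) i j| <=
      C * 2^-1 ^+ k.+1 * expR (2 * K * (t - a)) by rewrite !mxE.
  apply: (antiderivative_norm_le (s := [::]) at_
    (antiderivative_sub yy (lexx a) tb) (antiderivative_exp _ _ _ _)).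
    move=> u uat _.
    have uab : u \in `]a, b[ by exact: sub_itvoo uat.
    rewrite -mulmxBr.
    apply: le_trans (MD _ _ (C * 2^-1 ^+ k * expR (2 * K * (u - a))) _ _ uab _) _.
      by move=> l n; rewrite !mxE; apply: IH; exact: subset_itv_oo_cc.
    by rewrite exprS le_eqVlt; apply/orP; left; apply/eqP; field.
  by rewrite !mxE !ya subrr normr0 mulr_ge0 ?expR_ge0// mulr_ge0// exprn_ge0// invr_ge0.
pose E := C * expR (2 * K * (b - a)).
have yE k t i j : t \in `[a, b] -> `|y k.+1 t i j - y k t i j| <= E * 2^-1 ^+ k.
  move=> tab; apply: le_trans (yd k t i j tab) _.
  rewrite mulrAC /E ler_wpM2r ?exprn_ge0 ?invr_ge0// ler_wpM2l// ler_expR.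
  rewrite ler_wpM2l ?mulr_ge0// lerB//.
  by move: tab; rewrite in_itv/= => /andP[].
have /choice[Y YE] : forall t, exists Yt : 'M[R]_(p, q), t \in `[a, b] ->
    forall k i j, `|Yt i j - y k t i j| <= 2 * E * 2^-1 ^+ k.
  move=> t; have [tab|tab] := boolP (t \in `[a, b]); last by exists 0.
  have /choice[l lE] : forall ij : 'I_p * 'I_q, exists l, forall k,
      `|l - y k t ij.1 ij.2| <= 2 * E * 2^-1 ^+ k.
    by move=> ij; apply: geometric_limit => k; exact: yE.
  by exists (\matrix_(i, j) l (i, j)) => _ k i j; rewrite mxE; exact: (lE (i, j)).
have Yc : {within `[a, b], continuous Y}.
  apply/subspace_continuousP => x xab; apply/cvg_mxP => i j.
  apply/cvgrPdist_le => e e0.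
  have e3 : 0 < e / 3 by lra.
  have [k kE] := geometric_small (2 * E) e3.
  have : y k u i j @[u --> within `[a, b] (nbhs x)] --> y k x i j.
    exact: ((cvg_mxP _ _).1 (within_continuous_cvg (yc k) xab)).
  move=> /cvgrPdist_le/(_ _ e3) xk.
  near=> u.
  have uab : u \in `[a, b] by near: u; exact: withinT.
  have h1 := le_trans (YE x xab k i j) kE.
  have h2 := le_trans (YE u uab k i j) kE.
  have h3 : `|y k x i j - y k u i j| <= e / 3 by near: u.
  move: h1 h2 h3; rewrite !ler_norml => /andP[? ?] /andP[? ?] /andP[? ?].
  by apply/andP; split; lra.
(* The limit [Y] is a fixed point: [Phi Y - y (k+1)] has derivative
   [M (Y - y k)], which tends to zero geometrically. *)
have [gA ga] := PhiP _ Yc.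
have gY t : t \in `[a, b] -> Phi Y t = Y t.
  move=> tab; apply/matrixP => i j; apply/eqP; rewrite -subr_eq0 -normr_le0.
  move: (tab); rewrite in_itv/= => /andP[at_ tb].
  apply: (@le_geometric_le0 (K * (2 * E) * (t - a) + E)) => k.
  have gy := (antiderivative_mxP _ _ _ _).1
    (antiderivativeD gA (antiderivativeN (yA k))) i j.
  have h1 : `|Phi Y t i j - y k.+1 t i j| <= K * (2 * E * 2^-1 ^+ k) * (t - a).
    suff: `|(Phi Y t - y k.+1 t) i j| <= K * (2 * E * 2^-1 ^+ k) * (t - a).
      by rewrite !mxE.
    apply: (antiderivative_norm_le (s := [::]) at_
      (antiderivative_sub gy (lexx a) tb) (antiderivative_linear _ _ _)); last first.
      by rewrite !mxE ga ya !subrr normr0 mulr0.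
    move=> u uat _.
    have uab : u \in `]a, b[ by exact: sub_itvoo uat.
    rewrite -mulmxBr; apply: MD => // l n; rewrite !mxE; apply: YE.
    exact: subset_itv_oo_cc.
  have h2 := YE t tab k.+1 i j.
  rewrite -(subrKA (y k.+1 t i j)); apply: le_trans (ler_normD _ _) _.
  rewrite [X in _ + X <= _]distrC.
  apply: le_trans (lerD h1 h2) _.
  by rewrite exprS le_eqVlt; apply/orP; left; apply/eqP; field.
exists Y; last by rewrite -gY ?ga// in_itv/= lexx.
by apply: (antiderivative_eq (s := [::]) gA).
Unshelve. all: by end_near. Qed.

End LinearODE.

(** Identities in the additive group of matrices, all products being treated as
    atoms. *)
Ltac mx_abel :=
  repeat match goal with |- context [?X *m ?Y] =>
    let Z := fresh "Z" in move: (X *m Y) => Z end;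
  let i := fresh "i" in let j := fresh "j" in
  apply/matrixP => i j; rewrite !mxE; ring.

Section LinearODETheory.
Context {R : realType}.

Lemma antiderivative_piecewise_continuous (V : normedModType R) (a b : R) (f g : R -> V) :
  antiderivative a b f g -> piecewise_continuous a b g.
Proof. by case=> gc _; exact: piecewise_continuous_within. Qed.

Lemma piecewise_continuous_cst (V : normedModType R) (a b : R) (c : V) :
  piecewise_continuous a b (fun=> c).
Proof. exact: antiderivative_piecewise_continuous (antiderivative_cst a b c). Qed.

(** [Psi] solves the adjoint equation, so [Psi Phi] has zero derivative and
    stays equal to its initial value. *)
Lemma fundamental_matrix p (a b : R) (M : R -> 'M[R]_p) :
  a <= b -> piecewise_continuous a b M ->
  exists Phi Psi : R -> 'M[R]_p,
    [/\ antiderivative a b (fun t => M t *m Phi t) Phi,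
        antiderivative a b (fun t => - (Psi t *m M t)) Psi,
        forall t, t \in `[a, b] -> Psi t *m Phi t = 1%:M &
        forall t, t \in `[a, b] -> Phi t *m Psi t = 1%:M].
Proof.
move=> ab Mc.
have [Phi dPhi Phia] := linear_ode_ex 1%:M ab Mc.
have [Y dY Ya] := linear_ode_ex (1%:M : 'M[R]_p) ab
  (piecewise_continuousN (piecewise_continuous_trmx Mc)).
have dPsi : antiderivative a b (fun t => - ((Y t)^T *m M t)) (fun t => (Y t)^T).
  apply: (antiderivative_eq (s := [::]) (antiderivative_trmx dY)) => // t _ _.
  by rewrite trmx_mul linearN/= trmxK mulmxN.
have inv t : t \in `[a, b] -> (Y t)^T *m Phi t = 1%:M.
  move=> tab; rewrite -[RHS](_ : (Y a)^T *m Phi a = _); last first.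
    by rewrite Ya Phia trmx1 mulmx1.
  have aab : a \in `[a, b] by rewrite in_itv/= lexx.
  apply: (antiderivative0_cst (g := fun t => (Y t)^T *m Phi t) _ tab aab).
  apply: (antiderivative_eq (s := [::]) (antiderivative_mulmx dPsi dPhi)) => // u _ _.
  by rewrite mulNmx mulmxA addNr.
exists Phi, (fun t => (Y t)^T); split=> // t tab.
by apply: mulmx1C; exact: inv.
Qed.

(** Invertibility of the fundamental matrix turns a terminal condition into an
    initial one. *)
Lemma linear_ode_terminal_ex p q (a b : R) (M : R -> 'M[R]_p) (Yb : 'M[R]_(p, q)) :
  a <= b -> piecewise_continuous a b M ->
  exists2 Y, antiderivative a b (fun t => M t *m Y t) Y & Y b = Yb.
Proof.
move=> ab Mc; have [Phi [Psi [dPhi _ _ PhiPsi]]] := fundamental_matrix ab Mc.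
exists (fun t => Phi t *m (Psi b *m Yb)); last first.
  by rewrite mulmxA PhiPsi ?mul1mx// in_itv/= ab lexx.
apply: (antiderivative_eq (s := [::]) (antiderivative_mulmx dPhi
  (antiderivative_cst a b (Psi b *m Yb)))) => // t _ _.
by rewrite mulmx0 addr0 -mulmxA.
Qed.

(** With [Psi1' = - Psi1 M] and [Phi2' = - N Phi2], the product
    [Psi1 D Phi2] has zero derivative and vanishes at [b]. *)
Lemma sylvester_ode_unique p q (a b : R) (M : R -> 'M[R]_p) (N : R -> 'M[R]_q)
    (D : R -> 'M[R]_(p, q)) :
  a <= b -> piecewise_continuous a b M -> piecewise_continuous a b N ->
  antiderivative a b (fun t => M t *m D t + D t *m N t) D -> D b = 0 ->
  forall t, t \in `[a, b] -> D t = 0.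
Proof.
move=> ab Mc Nc dD Db t tab.
have [Phi1 [Psi1 [_ dPsi1 _ PhiPsi1]]] := fundamental_matrix ab Mc.
have [Phi2 [Psi2 [dPhi2 _ _ PhiPsi2]]] :=
  fundamental_matrix ab (piecewise_continuousN Nc).
have bab : b \in `[a, b] by rewrite in_itv/= ab lexx.
have : Psi1 t *m D t *m Phi2 t = Psi1 b *m D b *m Phi2 b.
  apply: (antiderivative0_cst (g := fun t => Psi1 t *m D t *m Phi2 t) _ tab bab).
  apply: (antiderivative_eq (s := [::]) (antiderivative_mulmx
    (antiderivative_mulmx dPsi1 dD) dPhi2)) => // u _ _.
  rewrite !(mulmxDl, mulmxDr, mulNmx, mulmxN) !mulmxA.  mx_abel.
rewrite Db mulmx0 mul0mx => E.
have := congr1 (fun Z => Phi1 t *m Z *m Psi2 t) E.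
by rewrite /= !mulmxA PhiPsi1// mul1mx -mulmxA PhiPsi2// mulmx1 mulmx0 mul0mx.
Qed.

(** The system is written for the stacked unknown [Y] with values in
    matrices with [n + n] rows; [E1] and [E2] below are the two block injections,
    so that [X = E1^T Y] and [L = E2^T Y]. *)
Lemma hamiltonian_ex n (a b : R) (A S Q : R -> 'M[R]_n) (Pb : 'M[R]_n) :
  a <= b -> piecewise_continuous a b A -> piecewise_continuous a b S ->
  piecewise_continuous a b Q -> exists X L : R -> 'M[R]_n,
  [/\ antiderivative a b (fun t => A t *m X t - S t *m L t) X,
      antiderivative a b (fun t => - (Q t *m X t) - (A t)^T *m L t) L,
      X b = 1%:M & L b = Pb].
Proof.
move=> ab Ac Sc Qc.
pose E1 : 'M[R]_(n + n, n) := col_mx 1%:M 0.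
pose E2 : 'M[R]_(n + n, n) := col_mx 0 1%:M.
have E11 : E1^T *m E1 = 1%:M.
  by rewrite tr_col_mx mul_row_col trmx1 mul1mx mulmx0 addr0.
have E12 : E1^T *m E2 = 0.
  by rewrite tr_col_mx mul_row_col mulmx0 trmx0 mul0mx addr0.
have E21 : E2^T *m E1 = 0.
  by rewrite tr_col_mx mul_row_col mulmx0 trmx0 mul0mx addr0.
have E22 : E2^T *m E2 = 1%:M.
  by rewrite tr_col_mx mul_row_col trmx1 mul1mx mulmx0 add0r.
pose M t := E1 *m (A t *m E1^T - S t *m E2^T) -
  E2 *m (Q t *m E1^T + (A t)^T *m E2^T).
have Mc : piecewise_continuous a b M.
  have c p q (C : 'M[R]_(p, q)) : piecewise_continuous a b (fun=> C).
    exact: piecewise_continuous_cst.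
  apply: piecewise_continuousD; last apply: piecewise_continuousN.
    apply: piecewise_continuous_mulmx => //; apply: piecewise_continuousD.
      exact: piecewise_continuous_mulmx.
    by apply: piecewise_continuousN; exact: piecewise_continuous_mulmx.
  apply: piecewise_continuous_mulmx => //; apply: piecewise_continuousD.
    exact: piecewise_continuous_mulmx.
  apply: piecewise_continuous_mulmx => //; exact: piecewise_continuous_trmx.
have [Y dY Yb] := linear_ode_terminal_ex (E1 + E2 *m Pb) ab Mc.
exists (fun t => E1^T *m Y t), (fun t => E2^T *m Y t); split.
- apply: (antiderivative_eq (s := [::])
    (antiderivative_mulmx (antiderivative_cst a b E1^T) dY)) => // t _ _.
  rewrite mul0mx add0r /M !(mulmxDl, mulmxDr, mulNmx, mulmxN) !mulmxA E11 E12.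
  by rewrite !mul1mx !mul0mx; mx_abel.
- apply: (antiderivative_eq (s := [::])
    (antiderivative_mulmx (antiderivative_cst a b E2^T) dY)) => // t _ _.
  rewrite mul0mx add0r /M !(mulmxDl, mulmxDr, mulNmx, mulmxN) !mulmxA E21 E22.
  by rewrite !mul1mx !mul0mx; mx_abel.
- by rewrite Yb mulmxDr mulmxA E11 E12 mul0mx addr0.
- by rewrite Yb mulmxDr mulmxA E21 E22 mul1mx add0r.
Qed.

End LinearODETheory.

(** * Quadratic forms *)

Section QuadraticForms.
Context {R : realType}.

Definition sym_possemidef k (M : 'M[R]_k) : Prop :=
  M^T = M /\ forall x : 'cV[R]_k, 0 <= (x^T *m M *m x) 0 0.

Lemma sym_posdef_psd k (M : 'M[R]_k) : sym_posdef M -> sym_possemidef M.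
Proof.
move=> [Ms Mp]; split=> // x; have [->|x0] := eqVneq x 0.
  by rewrite mulmx0 mxE.
exact/ltW/Mp.
Qed.

Lemma sym_posdef_eq0 k (M : 'M[R]_k) (x : 'cV[R]_k) :
  sym_posdef M -> (x^T *m M *m x) 0 0 = 0 -> x = 0.
Proof.
move=> [_ Mp] x0; apply/eqP; apply: contraT => /Mp.
by rewrite x0 ltxx.
Qed.

Lemma unitmx_inj k (M : 'M[R]_k) :
  (forall x : 'cV[R]_k, M *m x = 0 -> x = 0) -> M \in unitmx.
Proof.
move=> Minj; rewrite -unitmx_tr -row_free_unit -kermx_eq0.
apply/eqP/row_matrixP => i; rewrite row0.
apply: trmx_inj; rewrite trmx0; apply: Minj.
apply: trmx_inj; rewrite trmx_mul trmxK trmx0 -row_mul mulmx_ker.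
by rewrite row0.
Qed.

Lemma sym_posdef_unit k (M : 'M[R]_k) : sym_posdef M -> M \in unitmx.
Proof.
move=> Mp; apply: unitmx_inj => x Mx.
by apply: (sym_posdef_eq0 Mp); rewrite -mulmxA Mx mulmx0 mxE.
Qed.

Lemma psd_congr k l (M : 'M[R]_k) (N : 'M[R]_(k, l)) :
  sym_possemidef M -> sym_possemidef (N^T *m M *m N).
Proof.
move=> [Ms Mp]; split; first by rewrite !trmx_mul trmxK Ms mulmxA.
by move=> x; have := Mp (N *m x); rewrite trmx_mul !mulmxA.
Qed.

Lemma psd_invmx k (M : 'M[R]_k) : sym_posdef M -> sym_possemidef (invmx M).
Proof.
move=> Mp; have Mu := sym_posdef_unit Mp.
have := psd_congr (invmx M) (sym_posdef_psd Mp).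
by rewrite trmx_inv Mp.1 mulVmx// mul1mx.
Qed.

End QuadraticForms.

(** * The Riccati equation on one phase *)

Section RiccatiPhase.
Context {R : realType} (n m : nat) (a b : R).
Context (A : R -> 'M[R]_n) (B : R -> 'M[R]_(n, m)).
Context (Q : R -> 'M[R]_n) (W : R -> 'M[R]_m).
Hypothesis ab : a < b.
Hypotheses (Ac : piecewise_continuous a b A) (Bc : piecewise_continuous a b B).
Hypotheses (Qc : {within `[a, b], continuous Q})
  (Wc : {within `[a, b], continuous W}).
Hypotheses (Qp : forall t, t \in `[a, b] -> sym_posdef (Q t))
  (Wp : forall t, t \in `[a, b] -> sym_posdef (W t)).

Let S t := B t *m invmx (W t) *m (B t)^T.

Lemma invmx_piecewise_continuous :
  piecewise_continuous a b (fun t => invmx (W t)).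
Proof.
apply: piecewise_continuous_within; apply/subspace_continuousP => t tab.
apply: cvg_invmx; first exact/sym_posdef_unit/Wp.
exact: within_continuous_cvg.
Qed.

Let Sc : piecewise_continuous a b S.
Proof.
apply: piecewise_continuous_mulmx (piecewise_continuous_trmx Bc).
exact: piecewise_continuous_mulmx Bc invmx_piecewise_continuous.
Qed.

Let S_psd t : t \in `[a, b] -> sym_possemidef (S t).
Proof.
move=> tab; have := psd_congr (B t)^T (psd_invmx (Wp tab)).
by rewrite trmxK.
Qed.

(** For [D = P - P'], the quadratic terms give
    [P S P - P' S P' = D S P + P' S D], so that [D] solves the linear equation
    [D' = (- A^T + P' S) D + D (- A + S P)]. *)
Lemma riccati_unique (P P' : R -> 'M[R]_n) :
  solves_ode a b (riccati_rhs Q W A B) P ->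
  solves_ode a b (riccati_rhs Q W A B) P' -> P b = P' b ->
  forall t, t \in `[a, b] -> P t = P' t.
Proof.
move=> dP dP' Pb t tab; apply/eqP; rewrite -subr_eq0; apply/eqP.
have Pc : piecewise_continuous a b P by apply: piecewise_continuous_within; case: dP.
have Pc' : piecewise_continuous a b P' by apply: piecewise_continuous_within; case: dP'.
apply: (@sylvester_ode_unique _ _ _ a b (fun t => - (A t)^T + P' t *m S t)
  (fun t => - A t + S t *m P t) (fun t => P t - P' t) _ _ _ _ _ t tab).
- exact: ltW.
- apply: piecewise_continuousD.
    exact: piecewise_continuousN (piecewise_continuous_trmx Ac).
  exact: piecewise_continuous_mulmx.
- apply: piecewise_continuousD; first exact: piecewise_continuousN.
  exact: piecewise_continuous_mulmx.
- have ad : antiderivative a b (fun t => riccati_rhs Q W A B t (P t) -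
      riccati_rhs Q W A B t (P' t)) (fun t => P t - P' t).
    exact: antiderivativeD dP (antiderivativeN dP').
  apply: (antiderivative_eq (s := [::]) ad) => // u _ _.
  rewrite /riccati_rhs !(mulmxDl, mulmxDr, mulmxBl, mulmxBr, mulNmx, mulmxN) /S !mulmxA.
  by mx_abel.
- by rewrite Pb subrr.
Qed.

(** [P = L X^-1], with [(X, L)] the Hamiltonian pair. The function [G = X^T L]
    carries the proof: its derivative [g] is symmetric and negative semidefinite,
    which makes [G] symmetric and positive semidefinite (as it is at [b]), shows
    that [X] is invertible, and passes to [P = X^-T G X^-1]. *)
Lemma riccati_ex (Pb : 'M[R]_n) : sym_possemidef Pb ->
  exists P : R -> 'M[R]_n,
    [/\ solves_ode a b (riccati_rhs Q W A B) P, P b = Pb &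
        forall t, t \in `[a, b] -> sym_possemidef (P t)].
Proof.
move=> [Pbs Pbp].
(* [S'] is an opaque copy of [S], so that rewriting does not unfold it. *)
have [S' [SE S'c S'_psd]] : exists S', [/\ S' =1 S, piecewise_continuous a b S' &
    forall t, t \in `[a, b] -> sym_possemidef (S' t)] by exists S.
have [X [L [dX dL Xb Lb]]] := hamiltonian_ex Pb (ltW ab) Ac S'c
  (piecewise_continuous_within Qc).
have bab : b \in `[a, b] by rewrite in_itv/= ltW// lexx.
pose G t := (X t)^T *m L t.
pose g t := - ((L t)^T *m S' t *m L t + (X t)^T *m Q t *m X t).
have dG : antiderivative a b g G.
  apply: (antiderivative_eq (s := [::])
    (antiderivative_mulmx (antiderivative_trmx dX) dL)) => // t tab _.
  have [Ss _] := S'_psd _ (subset_itv_oo_cc tab).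
  rewrite /g linearB/= !trmx_mul Ss.
  rewrite !(mulmxDl, mulmxDr, mulNmx, mulmxN) !mulmxA.
  by mx_abel.
have gsym t : t \in `[a, b] -> (g t)^T = g t.
  move=> tab; have [Ss _] := S'_psd _ tab; have [Qs _] := Qp tab.
  by rewrite /g linearN linearD/= !trmx_mul !trmxK Ss Qs !mulmxA.
have Gb : G b = Pb by rewrite /G Xb Lb trmx1 mul1mx.
have Gsym t : t \in `[a, b] -> (G t)^T = G t.
  move=> tab; apply/eqP; rewrite -subr_eq0; apply/eqP.
  rewrite (_ : 0 = (G b)^T - G b); last by rewrite Gb Pbs subrr.
  apply: (antiderivative0_cst (g := fun t => (G t)^T - G t) _ tab bab).
  apply: (antiderivative_eq (s := [::]) (antiderivativeD
    (antiderivative_trmx dG) (antiderivativeN dG))) => // u uab _.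
  by rewrite gsym ?subrr//; exact: subset_itv_oo_cc.
pose w (c : 'cV[R]_n) t := - (c^T *m G t *m c) 0 0.
have dw c : antiderivative a b (fun t => - (c^T *m g t *m c) 0 0) (w c).
  apply: antiderivativeN.
  apply: (antiderivative_eq (s := [::]) ((antiderivative_mxP _ _ _ _).1
   (antiderivative_mulmx (antiderivative_mulmx (antiderivative_cst a b c^T) dG)
     (antiderivative_cst a b c)) 0 0)) => // t _ _.
  by rewrite mul0mx add0r mulmx0 addr0.
have gE (c : 'cV[R]_n) t : - (c^T *m g t *m c) 0 0 =
    ((L t *m c)^T *m S' t *m (L t *m c)) 0 0 +
    ((X t *m c)^T *m Q t *m (X t *m c)) 0 0.
  rewrite /g !trmx_mul !(mulmxDl, mulmxDr, mulNmx, mulmxN) !mulmxA.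
  by rewrite mxE opprK mxE.
have g0 (c : 'cV[R]_n) t : t \in `[a, b] -> 0 <= - (c^T *m g t *m c) 0 0.
  move=> tab; rewrite gE addr_ge0//; first exact: (S'_psd _ tab).2.
  exact: (sym_posdef_psd (Qp tab)).2.
have Gp t : t \in `[a, b] -> forall c : 'cV[R]_n, 0 <= (c^T *m G t *m c) 0 0.
  rewrite in_itv/= => /andP[at_ tb] c.
  apply: le_trans (Pbp c) _; rewrite -lerN2 -Gb.
  apply: (antiderivative_ge0_le (s := [::]) tb
    (antiderivative_sub (dw c) at_ (lexx b))) => u utb _.
  by apply: g0; apply: subset_itv_oo_cc; exact: sub_itvoo utb.
have Xu t : t \in `[a, b] -> X t \in unitmx.
  rewrite in_itv/= => /andP[at_ tb]; apply: unitmx_inj => c Xc.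
  have [tb'|bt] := ltP t b; last first.
    have E : t = b by apply/eqP; rewrite eq_le tb bt.
    by move: Xc; rewrite E Xb mul1mx.
  have [||s gs] := antiderivative_ge0_eq0 (s := [::]) tb
    (antiderivative_sub (dw c) at_ (lexx b)).
  - move=> u utb _; apply: g0; apply: subset_itv_oo_cc; exact: sub_itvoo utb.
  - rewrite /w Gb lerN2 /G mulmxA -trmx_mul Xc trmx0 !mul0mx mxE.
    exact: Pbp.
  have Xcb : X u *m c @[u --> b^'-] --> c.
    have Xl : {within `[a, b], continuous X} by case: dX.
    rewrite -{2}(mul1mx c) -Xb; apply: cvg_mulmx; last exact: cvg_cst.
    have [_ _] := (continuous_within_itvP X ab).1 Xl; exact.
  (* [X u c] tends to [c], and is zero at times arbitrarily close to [b]. *)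
  apply/eqP; apply: contraT => c0.
  near b^'- => u.
  have : X u *m c != 0 by near: u; exact: (cvgr_neq0 _ Xcb).
  have utb : u \in `]t, b[.
    rewrite in_itv/=; apply/andP; split; near: u.
      exact: nbhs_left_gt.
    exact: nbhs_left_lt.
  have uab : u \in `[a, b] by apply: subset_itv_oo_cc; exact: sub_itvoo utb.
  have us : u \notin s by near: u; exact: near_left_notin.
  move=> /negP[]; apply/eqP; apply: (sym_posdef_eq0 (Qp uab)).
  have := gs u utb us; rewrite gE => /eqP; rewrite paddr_eq0.
  - by move=> /andP[_ /eqP].
  - exact: (S'_psd _ uab).2.
  - exact: (sym_posdef_psd (Qp uab)).2.
exists (fun t => L t *m invmx (X t)); split.
- apply: (antiderivative_eq (s := [::])
    (antiderivative_mulmx dL (antiderivative_invmx dX Xu))) => // t tab _.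
  have Xtu := Xu t (subset_itv_oo_cc tab).
  rewrite /riccati_rhs !(mulmxDl, mulmxDr, mulNmx, mulmxN) !mulmxA.
  rewrite !mulmxK// SE /S !mulmxA.
  by mx_abel.
- by rewrite Lb Xb invmx1 mulmx1.
- move=> t tab; have Xtu := Xu t tab.
  have -> : L t *m invmx (X t) = (invmx (X t))^T *m G t *m invmx (X t).
    by rewrite /G mulmxA -trmx_mul mulmxV// trmx1 mul1mx.
  by apply: psd_congr; split; [exact: Gsym|exact: Gp].
Unshelve. all: by end_near. Qed.

End RiccatiPhase.
(** * Regularity of the linearization *)

Section Linearization.
Context {R : realType}.

Lemma Jac_comp (V : normedModType R) k l (f : V -> 'cV[R]_l)
    (h dh : 'cV[R]_k -> V) x :
  is_diff x h dh -> differentiable f (h x) ->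
  Jac (fun y => f (h y)) x =
  \matrix_(i < l, j < k) 'd f (h x) (dh (delta_mx j 0)) i 0.
Proof.
move=> hD fD; apply/matrixP => i j; rewrite !mxE.
have -> : (fun y => f (h y)) = f \o h by [].
by rewrite diff_comp//= diff_val.
Qed.

Lemma Jac_piecewise_continuous (V : normedModType R) k l (a b : R)
    (f : V -> 'cV[R]_l) (h : R -> 'cV[R]_k -> V) (dh : 'cV[R]_k -> V)
    (x : R -> 'cV[R]_k) :
  C1 f -> (forall t, is_diff (x t) (h t) dh) ->
  piecewise_continuous a b (fun t => h t (x t)) ->
  piecewise_continuous a b (fun t => Jac (fun y => f (h t y)) (x t)).
Proof.
move=> [fD fC] hD hc.
pose J p : 'M[R]_(l, k) := \matrix_(i, j) 'd f p (dh (delta_mx j 0)) i 0.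
have -> : (fun t => Jac (fun y => f (h t y)) (x t)) = (fun t => J (h t (x t))).
  by apply/funext => t; exact: Jac_comp.
apply: (piecewise_continuous_comp (h := J)) hc => p.
apply/(@cvg_mxP _ _ (nbhs p)) => i j; rewrite mxE.
under eq_fun do rewrite mxE.
exact: (cvg_comp _ _ (fC (dh (delta_mx j 0)) p) (@coord_continuous _ _ _ i 0 _)).
Qed.

(** Partial Jacobians are slices of the total differential, which is continuous
    for a [C1] map; along the trajectory it is composed with a piecewise
    continuous curve. *)
Lemma Jac1_piecewise_continuous n m (a b : R)
    (f : 'cV[R]_n -> 'cV[R]_m -> R -> 'cV[R]_n) (x : R -> 'cV[R]_n)
    (u : R -> 'cV[R]_m) :
  C1 (fun p : 'cV[R]_n * 'cV[R]_m * R => f p.1.1 p.1.2 p.2) ->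
  {within `[a, b], continuous x} -> piecewise_continuous a b u ->
  piecewise_continuous a b (fun t => Jac (fun y => f y (u t) t) (x t)).
Proof.
move=> fC xc uc.
apply: (Jac_piecewise_continuous (h := fun t y => (y, u t, t))
  (dh := fun y => (y, 0, 0)) fC).
apply: piecewise_continuous_pair; last first.
  apply: piecewise_continuous_within; apply: continuous_subspaceT => y.
  exact: cvg_id.
by apply: piecewise_continuous_pair uc; exact: piecewise_continuous_within.
Qed.

Lemma Jac2_piecewise_continuous n m (a b : R)
    (f : 'cV[R]_n -> 'cV[R]_m -> R -> 'cV[R]_n) (x : R -> 'cV[R]_n)
    (u : R -> 'cV[R]_m) :
  C1 (fun p : 'cV[R]_n * 'cV[R]_m * R => f p.1.1 p.1.2 p.2) ->
  {within `[a, b], continuous x} -> piecewise_continuous a b u ->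
  piecewise_continuous a b (fun t => Jac (fun w => f (x t) w t) (u t)).
Proof.
move=> fC xc uc.
apply: (Jac_piecewise_continuous (h := fun t w => (x t, w, t))
  (dh := fun w => (0, w, 0)) fC) => [t|].
  by apply: is_diff_pair; apply: is_diff_pair.
apply: piecewise_continuous_pair; last first.
  apply: piecewise_continuous_within; apply: continuous_subspaceT => y.
  exact: cvg_id.
by apply: piecewise_continuous_pair uc; exact: piecewise_continuous_within.
Qed.

End Linearization.

(** * Completing the square on one phase *)

Section CompletingTheSquare.
Context {R : realType} (n m : nat) (a b : R).
Context (A : R -> 'M[R]_n) (B : R -> 'M[R]_(n, m)).
Context (Q : R -> 'M[R]_n) (W : R -> 'M[R]_m).
Hypothesis ab : a < b.
Hypothesis Wp : forall t, t \in `[a, b] -> sym_posdef (W t).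
Context (P : R -> 'M[R]_n).
Hypothesis dP : solves_ode a b (riccati_rhs Q W A B) P.
Hypothesis Psym : forall t, t \in `[a, b] -> (P t)^T = P t.
Context (z : R -> 'cV[R]_n) (v : R -> 'cV[R]_m) (G : R -> R).
Hypothesis dz : solves_ode a b (fun t x => A t *m x + B t *m v t) z.
Hypothesis dG : antiderivative a b
  (fun t => ((z t)^T *m Q t *m z t) 0 0 + ((v t)^T *m W t *m v t) 0 0) G.

Let K t := invmx (W t) *m (B t)^T *m P t.
Let value t := ((z t)^T *m P t *m z t) 0 0 + G t.

(** The Riccati equation cancels [z^T Q z] and all terms in [A]; what is left
    of [z^T P z + G] is the expanded square. *)
Lemma antiderivative_value :
  antiderivative a b
    (fun t => ((v t + K t *m z t)^T *m W t *m (v t + K t *m z t)) 0 0) value.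
Proof.
have dzPz := (antiderivative_mxP _ _ _ _).1 (antiderivative_mulmx
  (antiderivative_mulmx (antiderivative_trmx dz) dP) dz) 0 0.
apply: (antiderivative_eq (s := [::]) (antiderivativeD dzPz dG)) => // t tab _.
have addE (M N : 'M[R]_1) : M 0 0 + N 0 0 = (M + N) 0 0 by rewrite mxE.
rewrite !addE; congr (fun_of_matrix _ 0 0).
have tab' := subset_itv_oo_cc tab.
have Wu := sym_posdef_unit (Wp tab'); have [Wsym _] := Wp tab'.
rewrite /riccati_rhs /K !linearD/= !trmx_mul trmx_inv trmxK Wsym Psym//.
rewrite !(mulmxDl, mulmxDr, mulNmx, mulmxN) !mulmxA.
rewrite !mulmxK// !mulmxKV//.
mx_abel.
Qed.

Lemma value_le : value a <= value b.
Proof.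
apply: (antiderivative_ge0_le (s := [::]) (ltW ab) antiderivative_value) => t tab _.
exact: (sym_posdef_psd (Wp (subset_itv_oo_cc tab))).2.
Qed.

(** Along the feedback law the derivative of the value is zero, and the opposite
    inequality to [value_le] holds. *)
Lemma feedback_value_le (s : seq R) :
  (forall t, t \in `]a, b[ -> t \notin s -> v t = - (K t *m z t)) ->
  value b <= value a.
Proof.
move=> vK; rewrite -lerN2.
apply: (antiderivative_ge0_le (s := s) (ltW ab) (antiderivativeN antiderivative_value)).
by move=> t tab ts; rewrite vK// addNr mulmx0 mxE oppr0.
Qed.

Lemma value_eq_feedback : value b <= value a ->
  exists s : seq R, forall t, t \in `]a, b[ -> t \notin s ->
    v t = - (K t *m z t).
Proof.
move=> vba.
have [|//|s vs] := antiderivative_ge0_eq0 (s := [::]) (ltW ab)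
  antiderivative_value.
  by move=> t tab _; exact: (sym_posdef_psd (Wp (subset_itv_oo_cc tab))).2.
exists s => t tab ts; apply/eqP; rewrite -addr_eq0; apply/eqP.
exact: sym_posdef_eq0 (Wp (subset_itv_oo_cc tab)) (vs t tab ts).
Qed.

End CompletingTheSquare.

(** * The closed loop *)

Lemma feedback_ode_ex {R : realType} (n m : nat) (a b : R)
    (A : R -> 'M[R]_n) (B : R -> 'M[R]_(n, m)) (K : R -> 'M[R]_(m, n)) (za : 'cV[R]_n) :
  a <= b -> piecewise_continuous a b A -> piecewise_continuous a b B ->
  piecewise_continuous a b K ->
  exists z, [/\ antiderivative a b (fun t => A t *m z t - B t *m (K t *m z t)) z,
    piecewise_continuous a b (fun t => - (K t *m z t)) & z a = za].
Proof.
move=> ab Ac Bc Kc.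
have [z dz za0] := linear_ode_ex za ab (piecewise_continuousD Ac
  (piecewise_continuousN (piecewise_continuous_mulmx Bc Kc))).
exists z; split=> //.
  apply: (antiderivative_eq (s := [::]) dz) => // t _ _.
  by rewrite mulmxBl mulmxA.
apply: piecewise_continuousN; apply: piecewise_continuous_mulmx => //.
exact: antiderivative_piecewise_continuous dz.
Qed.
(** * The two phases together *)

Section JumpLQSolution.
Context {R : realType} (n m : nat) (t0 tau T : R).
Hypotheses (ht0 : t0 < tau) (hT : tau < T).
Context (Aa Ap : R -> 'M[R]_n) (Ba Bp : R -> 'M[R]_(n, m)) (H : 'M[R]_n).
Context (Q : R -> 'M[R]_n) (W : R -> 'M[R]_m) (PT : 'M[R]_n).
Hypotheses (Aac : piecewise_continuous t0 tau Aa)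
  (Bac : piecewise_continuous t0 tau Ba)
  (Apc : piecewise_continuous tau T Ap)
  (Bpc : piecewise_continuous tau T Bp).
Hypotheses (Qc : {within `[t0, T], continuous Q})
  (Wc : {within `[t0, T], continuous W}).
Hypotheses (Qp : forall t, t \in `[t0, T] -> sym_posdef (Q t))
  (Wp : forall t, t \in `[t0, T] -> sym_posdef (W t))
  (PTp : sym_possemidef PT).

Let ante t : t \in `[t0, tau] -> t \in `[t0, T].
Proof. by rewrite !in_itv/= => /andP[-> /le_trans]; apply; exact: ltW. Qed.

Let post t : t \in `[tau, T] -> t \in `[t0, T].
Proof. by rewrite !in_itv/= => /andP[tt ->]; rewrite (le_trans (ltW ht0)). Qed.

Let riccati := jump_riccati t0 tau T Aa Ap Ba Bp H Q W PT.
Let adm := admissible t0 tau T Aa Ap Ba Bp H.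

(** Backwards in time: the value at [tau] that starts the ante-event phase is a
    congruence of [Pp tau], hence still positive semidefinite, but possibly
    singular. *)
Lemma jump_riccati_ex : exists Pa Pp : R -> 'M[R]_n,
  [/\ solves_ode t0 tau (riccati_rhs Q W Aa Ba) Pa /\
        solves_ode tau T (riccati_rhs Q W Ap Bp) Pp,
      Pa tau = (1%:M + H)^T *m Pp tau *m (1%:M + H), Pp T = PT,
      forall t, t \in `[t0, tau] -> sym_possemidef (Pa t) &
      forall t, t \in `[tau, T] -> sym_possemidef (Pp t)].
Proof.
have [Pp [dPp PpT Ppp]] := riccati_ex hT Apc Bpc (continuous_subspaceW post Qc)
  (continuous_subspaceW post Wc) (fun t tp => Qp (post tp))
  (fun t tp => Wp (post tp)) PTp.
have tauT : tau \in `[tau, T] by rewrite in_itv/= lexx ltW.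
have [Pa [dPa Patau Pap]] := riccati_ex ht0 Aac Bac (continuous_subspaceW ante Qc)
  (continuous_subspaceW ante Wc) (fun t tp => Qp (ante tp))
  (fun t tp => Wp (ante tp))
  (psd_congr (1%:M + H) (Ppp _ tauT)).
by exists Pa, Pp; split.
Qed.

Lemma jump_riccati_unique (P P' : R -> 'M[R]_n) : riccati P -> riccati P' ->
  forall t, t \in `[t0, T] -> t != tau -> P' t = P t.
Proof.
move=> [PT_ [Pa [Pp [dPa dPp PJ Pae Ppe]]]].
move=> [PT'_ [Pa' [Pp' [dPa' dPp' PJ' Pae' Ppe']]]].
have TT : T \in `]tau, T] by rewrite in_itv/= hT lexx.
have PpE t : t \in `[tau, T] -> Pp' t = Pp t.
  apply: (riccati_unique hT Apc Bpc (continuous_subspaceW post Wc)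
    (fun t tp => Wp (post tp)) dPp' dPp).
  by rewrite -Ppe// -Ppe'// PT_ PT'_.
have PaE t : t \in `[t0, tau] -> Pa' t = Pa t.
  apply: (riccati_unique ht0 Aac Bac (continuous_subspaceW ante Wc)
    (fun t tp => Wp (ante tp)) dPa' dPa).
  by rewrite PJ PJ' PpE// in_itv/= lexx ltW.
move=> t; rewrite in_itv/= => /andP[t0t tT]; rewrite neq_lt => /orP[tt|tt].
  by rewrite Pae ?Pae' ?PaE// in_itv/= t0t//= ltW.
by rewrite Ppe ?Ppe' ?PpE// in_itv/= tT ?andbT//= ltW.
Qed.

Context (Pa Pp : R -> 'M[R]_n).
Hypotheses (dPa : solves_ode t0 tau (riccati_rhs Q W Aa Ba) Pa)
  (dPp : solves_ode tau T (riccati_rhs Q W Ap Bp) Pp)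
  (PJ : Pa tau = (1%:M + H)^T *m Pp tau *m (1%:M + H)) (PpT : Pp T = PT)
  (Pas : forall t, t \in `[t0, tau] -> (Pa t)^T = Pa t)
  (Pps : forall t, t \in `[tau, T] -> (Pp t)^T = Pp t).

Let P t := if t < tau then Pa t else Pp t.

Lemma jump_riccati_glue : riccati P.
Proof.
split; first by rewrite /P ltNge (ltW hT).
exists Pa, Pp; split=> // t; rewrite in_itv/= => /andP[h1 h2].
  by rewrite /P h2.
by rewrite /P ltNge (ltW h1).
Qed.

Let K := feedback_gain tau Ba Bp W P.

Let KaE t : t < tau -> K t = invmx (W t) *m (Ba t)^T *m Pa t.
Proof. by move=> tt; rewrite /K /feedback_gain /P tt. Qed.

Let KpE t : tau <= t -> K t = invmx (W t) *m (Bp t)^T *m Pp t.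
Proof. by rewrite leNgt => /negbTE tt; rewrite /K /feedback_gain /P tt. Qed.

(** The value [z^T P z + G] does not decrease on either phase and is continuous
    at the jump; it starts at [z0^T Pa(t0) z0] and ends at twice the cost. Equality
    of the ends forces equality on each phase. *)
Lemma cost_value z0 z v : adm z0 z v ->
  (z0^T *m Pa t0 *m z0) 0 0 <= 2 * cost t0 T Q W PT z v /\
  (2 * cost t0 T Q W PT z v <= (z0^T *m Pa t0 *m z0) 0 0 <->
   exists s : seq R, forall t, t \in `[t0, T] -> t \notin s ->
     v t = - (K t *m z t)).
Proof.
move=> [vc [za [zp [dza dzp zJ zae zpe]]] z0E].
have t0T := lt_trans ht0 hT.
have zc : piecewise_continuous t0 T z.
  apply: (piecewise_continuous_glue (f := za) (g := zp) (ltW ht0) (ltW hT)).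
  - by apply: piecewise_continuous_within; case: dza.
  - by apply: piecewise_continuous_within; case: dzp.
  - by move=> t tt; apply: zae; exact: subset_itv_oo_co.
  - by move=> t tt; apply: zpe; exact: subset_itv_oo_oc.
pose l t := ((z t)^T *m Q t *m z t) 0 0 + ((v t)^T *m W t *m v t) 0 0.
have lc : piecewise_continuous t0 T l.
  have qf k (x : R -> 'cV[R]_k) M : piecewise_continuous t0 T x ->
      {within `[t0, T], continuous M} ->
      piecewise_continuous t0 T (fun t => ((x t)^T *m M t *m x t) 0 0).
    move=> xc Mc; apply: (piecewise_continuous_entry
      (f := fun t => (x t)^T *m M t *m x t)).
    exact: (piecewise_continuous_mulmx (piecewise_continuous_mulmx
      (piecewise_continuous_trmx xc) (piecewise_continuous_within Mc)) xc).
  by apply: piecewise_continuousD; exact: qf.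
pose G t := \int[@lebesgue_measure R]_(u in `[t0, t]) l u.
have dG : antiderivative t0 T l G by exact: antiderivative_integral (ltW t0T) lc.
have dGa : antiderivative t0 tau (fun t => ((za t)^T *m Q t *m za t) 0 0 +
    ((v t)^T *m W t *m v t) 0 0) G.
  apply: (antiderivative_eq (s := [::])
    (antiderivative_sub dG (lexx _) (ltW hT))) => // t tt _.
  by rewrite /l zae//; exact: subset_itv_oo_co.
have dGp : antiderivative tau T (fun t => ((zp t)^T *m Q t *m zp t) 0 0 +
    ((v t)^T *m W t *m v t) 0 0) G.
  apply: (antiderivative_eq (s := [::])
    (antiderivative_sub dG (ltW ht0) (lexx _))) => // t tt _.
  by rewrite /l zpe//; exact: subset_itv_oo_oc.
have Wpa t (tt : t \in `[t0, tau]) := Wp (ante tt).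
have Wpp t (tt : t \in `[tau, T]) := Wp (post tt).
have leA := value_le ht0 Wpa dPa Pas dza dGa.
have leP_ := value_le hT Wpp dPp Pps dzp dGp.
have startE : ((za t0)^T *m Pa t0 *m za t0) 0 0 + G t0 = (z0^T *m Pa t0 *m z0) 0 0.
  by rewrite -zae ?in_itv/= ?lexx// z0E /G set_itv1 Rintegral_set1 addr0.
have jumpE : ((za tau)^T *m Pa tau *m za tau) 0 0 = ((zp tau)^T *m Pp tau *m zp tau) 0 0.
  have -> : zp tau = (1%:M + H) *m za tau by rewrite mulmxDl mul1mx.
  by rewrite PJ trmx_mul !mulmxA.
have endE : 2 * cost t0 T Q W PT z v = ((zp T)^T *m Pp T *m zp T) 0 0 + G T.
  rewrite /cost -zpe ?in_itv/= ?hT ?lexx// PpT -mulrDr mulrA divff ?mul1r ?pnatr_eq0//.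
  by rewrite addrC.
rewrite endE -startE; split; first by rewrite (le_trans leA)// jumpE.
split=> [leE|[s vK]].
- (* The end points and [tau] are added, since each phase only controls its
     open interval. *)
  have [|sa vKa] := value_eq_feedback ht0 Wpa dPa Pas dza dGa.
    by rewrite jumpE (le_trans leP_).
  have [|sp vKp] := value_eq_feedback hT Wpp dPp Pps dzp dGp.
    by rewrite (le_trans leE)// -jumpE.
  exists [:: t0, tau, T & sa ++ sp] => t; rewrite in_itv/= => /andP[t0t tT].
  rewrite !in_cons mem_cat !negb_or => /and5P[t_t0 t_tau t_T tsa tsp].
  have {t0t}t0t : t0 < t by rewrite lt_neqAle eq_sym t_t0.
  have {tT}tT : t < T by rewrite lt_neqAle t_T.
  move: t_tau; rewrite neq_lt => /orP[tt|tt].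
    by rewrite KaE// zae ?vKa// in_itv/= ?t0t// ltW.
  by rewrite KpE ?(ltW tt)// zpe ?vKp// in_itv/= tt ?ltW.
- apply: (@le_trans _ _ (((zp tau)^T *m Pp tau *m zp tau) 0 0 + G tau)).
    apply: (feedback_value_le hT Wpp dPp Pps dzp dGp (s := s)) => t tt ts.
    rewrite vK//; last by apply: post; exact: subset_itv_oo_cc.
    rewrite zpe//; last exact: subset_itv_oo_oc.
    by rewrite KpE//; move: tt; rewrite in_itv/= => /andP[/ltW].
  rewrite -jumpE; apply: (feedback_value_le ht0 Wpa dPa Pas dza dGa (s := s)) => t tt ts.
  rewrite vK//; last by apply: ante; exact: subset_itv_oo_cc.
  rewrite zae//; last exact: subset_itv_oo_co.
  by rewrite KaE//; move: tt; rewrite in_itv/= => /andP[].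
Qed.

Lemma feedback_admissible z0 : exists z, adm z0 z (fun t => - (K t *m z t)).
Proof.
have Pac : piecewise_continuous t0 tau Pa.
  by apply: piecewise_continuous_within; case: dPa.
have Ppc : piecewise_continuous tau T Pp.
  by apply: piecewise_continuous_within; case: dPp.
have gain a b (B : R -> 'M[R]_(n, m)) (P0 : R -> 'M[R]_n) :
    piecewise_continuous a b B -> piecewise_continuous a b P0 ->
    {subset `[a, b] <= `[t0, T]} ->
    piecewise_continuous a b (fun t => invmx (W t) *m (B t)^T *m P0 t).
  move=> Bc Pc abT; apply: piecewise_continuous_mulmx Pc.
  apply: piecewise_continuous_mulmx (piecewise_continuous_trmx Bc).
  apply: invmx_piecewise_continuous; first exact: continuous_subspaceW Wc.
  by move=> t /abT; exact: Wp.
have [za [dza vac za0]] := feedback_ode_ex z0 (ltW ht0) Aac Bac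
  (gain _ _ _ _ Bac Pac ante).
have [zp [dzp vpc zptau]] := feedback_ode_ex (za tau + H *m za tau) (ltW hT) Apc Bpc
  (gain _ _ _ _ Bpc Ppc post).
pose z t := if t < tau then za t else zp t.
have zaE t : t < tau -> z t = za t by move=> tt; rewrite /z tt.
have zpE t : tau <= t -> z t = zp t by rewrite leNgt => /negbTE tt; rewrite /z tt.
exists z; split; last by rewrite zaE.
- apply: (piecewise_continuous_glue (ltW ht0) (ltW hT) vac vpc) => t;
    rewrite in_itv/= => /andP[h1 h2].
    by rewrite KaE// zaE.
  by rewrite KpE ?zpE// ltW.
- exists za, zp; split=> //.
  + apply: (antiderivative_eq (s := [::]) dza) => // t.
    rewrite in_itv/= => /andP[h1 h2] _.
    by rewrite KaE// zaE// mulmxN.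
  + apply: (antiderivative_eq (s := [::]) dzp) => // t.
    rewrite in_itv/= => /andP[h1 h2] _.
    by rewrite KpE ?zpE ?mulmxN// ltW.
  + by move=> t; rewrite in_itv/= => /andP[h1 h2]; exact: zaE.
  + by move=> t; rewrite in_itv/= => /andP[h1 h2]; rewrite zpE// ltW.
Qed.

(** The closed loop attains the lower bound of [cost_value], so being optimal
    means attaining this bound. *)
Lemma optimal_feedback z0 z v : adm z0 z v ->
  (optimal t0 tau T Aa Ap Ba Bp H Q W PT z0 z v <->
   exists s : seq R, forall t, t \in `[t0, T] -> t \notin s ->
     v t = - (K t *m z t)).
Proof.
move=> zv; have [_ costE] := cost_value zv; rewrite -costE; split=> [[_ zv_min]|zvP].
  have [z' z'v'] := feedback_admissible z0.
  have [_ [_ cost'E]] := cost_value z'v'.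
  by apply: le_trans (cost'E _); [rewrite ler_pM2l//; exact: zv_min|exists [::]].
split=> // z' v' z'v'; have [cost' _] := cost_value z'v'.
by rewrite -(@ler_pM2l _ 2)// (le_trans zvP).
Qed.

End JumpLQSolution.

Unset Implicit Arguments.

Theorem mainTheorem2 (R : realType) (n m : nat) (t0 tau T : R)
    (ht0 : t0 < tau) (hT : tau < T)
    (S : hybrid_system R n m) (N : nominal_trajectory S t0 tau T)
    (transversality : ev_dot N != 0)
    (Q : R -> 'M[R]_n) (W : R -> 'M[R]_m) (PT : 'M[R]_n)
    (Q_cont : {within `[t0, T], continuous Q})
    (W_cont : {within `[t0, T], continuous W})
    (Q_pd : forall t, t \in `[t0, T] -> sym_posdef (Q t))
    (W_pd : forall t, t \in `[t0, T] -> sym_posdef (W t))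
    (PT_pd : sym_posdef PT) :
  let riccati :=
    jump_riccati t0 tau T (Aa N) (Ap N) (Ba N) (Bp N) (jump_gain N) Q W PT in
  let adm :=
    admissible t0 tau T (Aa N) (Ap N) (Ba N) (Bp N) (jump_gain N) in
  let opt :=
    optimal t0 tau T (Aa N) (Ap N) (Ba N) (Bp N) (jump_gain N) Q W PT in
  exists P : R -> 'M[R]_n,
    [/\ riccati P,
        forall P', riccati P' ->
          forall t, t \in `[t0, T] -> t != tau -> P' t = P t &
        let K := feedback_gain tau (Ba N) (Bp N) W P in
        forall z0 : 'cV[R]_n,
          (exists z, adm z0 z (fun t => - (K t *m z t))) /\
          forall z v, adm z0 z v ->
            (opt z0 z v <->
             exists s : seq R, forall t, t \in `[t0, T] -> t \notin s ->
               v t = - (K t *m z t))].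
Proof.
move=> riccati adm opt.
have Aac : piecewise_continuous t0 tau (Aa N).
  apply: Jac1_piecewise_continuous (fa_C1 S) (alphaa_ode N).1 _.
  exact: piecewise_continuous_sub (mu_pc N) (lexx _) (ltW hT).
have Bac : piecewise_continuous t0 tau (Ba N).
  apply: Jac2_piecewise_continuous (fa_C1 S) (alphaa_ode N).1 _.
  exact: piecewise_continuous_sub (mu_pc N) (lexx _) (ltW hT).
have Apc : piecewise_continuous tau T (Ap N).
  apply: Jac1_piecewise_continuous (fp_C1 S) (alphap_ode N).1 _.
  exact: piecewise_continuous_sub (mu_pc N) (ltW ht0) (lexx _).
have Bpc : piecewise_continuous tau T (Bp N).
  apply: Jac2_piecewise_continuous (fp_C1 S) (alphap_ode N).1 _.
  exact: piecewise_continuous_sub (mu_pc N) (ltW ht0) (lexx _).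
have [Pa [Pp [[dPa dPp] PJ PpT Pap Ppp]]] := jump_riccati_ex ht0 hT
  (jump_gain N) Aac Bac Apc Bpc Q_cont W_cont Q_pd W_pd (sym_posdef_psd PT_pd).
have Pas t (tt : t \in `[t0, tau]) := (Pap t tt).1.
have Pps t (tt : t \in `[tau, T]) := (Ppp t tt).1.
have P_riccati := jump_riccati_glue hT dPa dPp PJ PpT.
exists (fun t => if t < tau then Pa t else Pp t); split.
- exact: P_riccati.
- move=> P' P'_riccati.
  exact: (jump_riccati_unique ht0 hT Aac Bac Apc Bpc W_cont W_pd P_riccati).
- move=> K z0; split.
    exact: (feedback_admissible ht0 hT _ Aac Bac Apc Bpc W_cont W_pd dPa dPp).
  move=> z v zv.
  exact: (optimal_feedback ht0 hT Aac Bac Apc Bpc Q_cont W_cont W_pd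
    dPa dPp PJ PpT Pas Pps zv).
Qed.
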